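(* For a set $\mathcal A\subset\mathbb R$ let $\chi_{\mathcal A}$ denote its characteristic function, and for $x\ge 1$ define $$\varphi(x):=\sum_{m=1}^\infty\sum_{n=1}^\infty\int_1^x\chi_{[2m-1,2m)}\!\left(\frac{x}{u}\right)\chi_{[2n-1,2n)}(u)\,\frac{du}{u},$$ where $[a,b)=\{x: a\le x<b\}$. Then for every complex $s$ with $\mathrm{Re}\, s>0$, $$s^2\int_1^\infty\varphi(x)\,x^{-s-1}\,dx=(1-2^{1-s})^2\zeta^2(s).$$
   Context: $\zeta(s)$ denotes the Riemann zeta-function (analytically continued; $(1-2^{1-s})\zeta(s)$ is entire). *)

(* Defs.v *)
From HB Require Import structures.
From mathcomp Require Import all_boot all_order all_algebra.
From mathcomp Require Import all_classical all_reals all_analysis.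
From mathcomp Require Export complex.
Export numFieldNormedType.Exports.
Set Implicit Arguments.
Unset Strict Implicit.
Unset Printing Implicit Defensive.
Import Order.TTheory GRing.Theory Num.Theory.
Local Open Scope classical_set_scope.
Local Open Scope ring_scope.
Local Open Scope complex_scope.

Definition cexp (R : realType) (z : R[i]) : R[i] :=
  (expR (complex.Re z))%:C * (cos (complex.Im z) +i* sin (complex.Im z)).

(* Principal value of a ^ z; only meant for a > 0. *)
Definition cpow (R : realType) (a : R) (z : R[i]) : R[i] :=
  cexp (z * (ln a)%:C).

(* R[i]^o is R[i] as a normed module over itself, with the topology of the
   modulus.  The order on R[i] is partial: 0 < r forces r to be real. *)
Definition analytic_at (R : realType) (f : R[i] -> R[i]) (z : R[i]) : Prop :=
  exists (a : nat -> R[i]) (r : R[i]), 0 < r /\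
    forall w : R[i], `|w - z| < r ->
      series (fun k => a k * (w - z) ^+ k) @ \oo --> (f w : R[i]^o).

(* zeta is the analytic continuation to C \ {1} (a connected domain, so it is
   unique there) of the Dirichlet series; its value at 1 is irrelevant. *)
Definition is_riemann_zeta (R : realType) (zeta : R[i] -> R[i]) : Prop :=
  (forall s : R[i], s != 1 -> analytic_at zeta s) /\
  (forall s : R[i], 1 < complex.Re s ->
     series (fun n => cpow (n.+1%:R : R) (- s)) @ \oo --> (zeta s : R[i]^o)).

(* f with its value at a replaced by its limit there: this is how an
   expression with a removable singularity at a is read at a. *)
Definition fill_at (R : realType) (a : R[i]) (f : R[i] -> R[i]) (s : R[i]) :
    R[i] :=
  if s == a then lim (f z @[z --> (a : R[i]^o)^'] : set_system R[i]^o) else f s.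

Definition cintegrable (R : realType) (D : set R) (f : R -> R[i]) : Prop :=
  (@lebesgue_measure R).-integrable D (fun x => (complex.Re (f x))%:E) /\
  (@lebesgue_measure R).-integrable D (fun x => (complex.Im (f x))%:E).

Definition cintegral (R : realType) (D : set R) (f : R -> R[i]) : R[i] :=
  (\int[@lebesgue_measure R]_(x in D) complex.Re (f x)) +i*
  (\int[@lebesgue_measure R]_(x in D) complex.Im (f x)).

Definition chi (R : realType) (m : nat) : R -> R :=
  \1_(`[2 * m%:R - 1, 2 * m%:R[%classic).

(* The summands are nonnegative and, for fixed x, only finitely many are
   nonzero, so fine discards nothing. *)
Definition phi (R : realType) (x : R) : R :=
  fine (\sum_(1 <= m <oo) \sum_(1 <= n <oo)
    \int[@lebesgue_measure R]_(u in `[1%R, x])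
      (chi m (x / u) * chi n u / u)%:E)%E.

(* Main.v *)
Require Import Defs.
From HB Require Import structures.
From mathcomp Require Import all_boot all_order all_algebra.
From mathcomp Require Import all_classical all_reals all_analysis.
From mathcomp Require Import measurable_realfun ring lra.
Import Order.TTheory GRing.Theory Num.Theory.
Local Open Scope classical_set_scope.
Local Open Scope ring_scope.
Local Open Scope complex_scope.

(** Let [X] be the characteristic function of the reals [v >= 1] with odd integer
    part.  Then [phi] is the multiplicative convolution of [X] with itself, so by
    Fubini its Mellin transform is [K(s)^2], where [K(s)] is the integral of
    [X(u) u^(-s-1)]; block by block, [s K(s)] is the sum of the alternating zeta
    series, which is [(1 - 2^(1-s)) zeta(s)] for [Re s > 1].

    To continue this identity to [Re s > 0] it suffices to move along horizontal
    lines [Im s = y] with [y <> 0], which avoid the pole at 1: the real and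
    imaginary parts of both sides are real analytic functions of [Re s] there.
    Real [s <> 1] is reached by continuity from above, and [s = 1], where the
    right-hand side is a limit, by continuity of [K].

    Complex quantities are handled through the real numbers [Re (c * z)] for
    arbitrary [c]: [c = 1] and [c = -i] give the real and imaginary parts. *)

Set Implicit Arguments.
Unset Strict Implicit.

Local Notation Re := complex.Re.
Local Notation Im := complex.Im.
Local Notation mu := lebesgue_measure.

(** * Real analytic functions of one real variable *)

(** Only pointwise convergence of the expansion is asked; the bounds on the coefficients used below
    are recovered from convergence at a single point. *)
Definition real_analytic_at (R : realType) (f : R -> R) (t : R) : Prop :=
  exists (a : nat -> R) (r : R), 0 < r /\
    forall u, `|u - t| < r ->
      series (fun k => a k * (u - t) ^+ k) @ \oo --> f u.

Lemma eq_cvgn (R : realType) (u v : nat -> R) (l : R) :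
  u =1 v -> u @ \oo --> l -> v @ \oo --> l.
Proof. by move=> /funext ->. Qed.

Lemma cvgn_unique (R : realType) (u : nat -> R) (l m : R) :
  u @ \oo --> l -> u @ \oo --> m -> l = m.
Proof. by move=> /cvg_lim <- // /cvg_lim <-. Qed.

Lemma geometric_tail_le (R : realType) (q : R) (k n : nat) :
  0 <= q -> q <= 2^-1 -> \sum_(k <= j < n) q ^+ j <= 2 * q ^+ k.
Proof.
move=> q0 q2.
have [kn|nk] := leqP k n; last first.
  by rewrite big_geq ?mulr_ge0 ?exprn_ge0 // ltnW.
suff : \sum_(k <= j < n) q ^+ j <= 2 * q ^+ k - 2 * q ^+ n.
  by move/le_trans; apply; rewrite gerBl mulr_ge0 ?exprn_ge0.
rewrite -(subnKC kn); elim: (n - k)%N => [|m IH].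
  by rewrite addn0 big_geq // subrr.
rewrite addnS big_nat_recr ?leq_addr //= exprSr.
have := exprn_ge0 (k + m) q0.
move: IH; set S := \sum_(_ <= _ < _) _; set Q := _ ^+ (k + m) => IH Q0.
by nra.
Qed.

(** The coefficient bound majorizes the terms by a geometric progression of ratio
    [|w| / rho <= 1/2], whose tail is at most twice its first term. *)
Lemma power_series_tail (R : realType) (a : nat -> R) (M rho w l : R) (k : nat) :
  0 < rho -> (forall j, `|a j| * rho ^+ j <= M) -> `|w| <= rho / 2 ->
  series (fun j => a j * w ^+ j) @ \oo --> l ->
  `|l - \sum_(0 <= j < k) a j * w ^+ j| <= 2 * M * (`|w| / rho) ^+ k.
Proof.
move=> rho0 aM wr cl.
have M0 : 0 <= M by rewrite (le_trans _ (aM 0%N)) // expr0 mulr1.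
set s := \sum_(_ <= _ < _) _.
have cn : `|series (fun j => a j * w ^+ j) n - s| @[n --> \oo] --> `|l - s|.
  by apply: cvg_norm; apply: cvgB => //; exact: cvg_cst.
rewrite -(cvg_lim (@Rhausdorff R) cn); apply: limr_le.
  by apply/cvg_ex; eexists; exact: cn.
exists k => //= n /= kn.
rewrite /series /= /s (@big_cat_nat _ _ _ k 0 n) //= addrAC subrr add0r.
apply: le_trans (ler_norm_sum _ _ _) _.
have q0 : 0 <= `|w| / rho by rewrite divr_ge0 // ltW.
apply: (@le_trans _ _ (\sum_(k <= j < n) M * (`|w| / rho) ^+ j)).
  apply: ler_sum => j _.
  rewrite normrM normrX expr_div_n mulrA ler_pdivlMr ?exprn_gt0 //.
  by rewrite mulrAC ler_wpM2r ?exprn_ge0.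
rewrite -mulr_sumr [2 * M]mulrC -mulrA ler_wpM2l //.
by apply: geometric_tail_le => //; rewrite ler_pdivrMr // mulrC.
Qed.

(** Convergence at the one point [t + r / 2] makes the terms there tend to 0, hence bounded; this is
    a Cauchy estimate with radius [rho = r / 2]. *)
Lemma real_analytic_bounded (R : realType) (f : R -> R) (t : R) :
  real_analytic_at f t ->
  exists (a : nat -> R) (rho M : R), [/\ 0 < rho,
    forall j, `|a j| * rho ^+ j <= M &
    forall u, `|u - t| <= rho ->
      series (fun k => a k * (u - t) ^+ k) @ \oo --> f u].
Proof.
move=> [a [r [r0 fa]]].
have r2 : 0 < r / 2 by rewrite divr_gt0.
have cr : series (fun k => a k * (r / 2) ^+ k) @ \oo --> f (t + r / 2).
  have := fa (t + r / 2); rewrite addrAC subrr add0r; apply.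
  by rewrite gtr0_norm //; lra.
have /cvg_series_cvg_0 c0 : cvgn (series (fun k => a k * (r / 2) ^+ k)).
  by apply/cvg_ex; eexists; exact: cr.
have /cvg_seq_bounded[M [_ HM]] : cvgn (fun k => a k * (r / 2) ^+ k).
  by apply/cvg_ex; eexists; exact: c0.
exists a, (r / 2), (M + 1); split => //.
- move=> j; have := HM (M + 1); rewrite ltrDl ltr01 => /(_ isT j I).
  by rewrite /= normrM normrX (gtr0_norm r2).
- by move=> u ut; apply: fa; lra.
Qed.

Lemma real_analytic_cst (R : realType) (c t : R) : real_analytic_at (cst c) t.
Proof.
exists (fun k => if k == 0%N then c else 0), 1; split => // u _.
rewrite /cst; apply: cvg_near_cst; exists 1%N => // n /= n0.
rewrite /series /= big_ltn // expr0 mulr1 big_nat big1 ?addr0 // => k.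
by case: k => // k _; rewrite mul0r.
Qed.

Lemma real_analytic_id (R : realType) (t : R) : real_analytic_at id t.
Proof.
exists (fun k => if k == 0%N then t else (k == 1%N)%:R), 1; split => // u _.
apply: cvg_near_cst; exists 2%N => // -[|[|n]] //= _.
rewrite /series /= big_nat_recl // big_nat_recl //= big1 => [|k _].
  by rewrite expr0 expr1 mulr1 mul1r addr0 addrC subrK.
by rewrite mul0r.
Qed.

Lemma real_analyticD (R : realType) (f g : R -> R) (t : R) :
  real_analytic_at f t -> real_analytic_at g t ->
  real_analytic_at (fun u => f u + g u) t.
Proof.
move=> [a [r [r0 fa]]] [b [s [s0 gb]]].
exists (fun k => a k + b k), (Num.min r s); split; first by rewrite lt_min r0.
move=> u; rewrite lt_min => /andP[ur us].
have : series (fun k => a k * (u - t) ^+ k) n + series (fun k => b k * (u - t) ^+ k) n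
    @[n --> \oo] --> f u + g u by apply: cvgD; [exact: fa | exact: gb].
apply: eq_cvgn => n.
by rewrite /series /= -big_split /=; apply: eq_bigr => k _; rewrite mulrDl.
Qed.

(** Regroups the antidiagonals of the triangle [i + j < n] into rows, for the partial sums of a
    Cauchy product. *)
Lemma sum_triangle (V : zmodType) (F : nat -> nat -> V) (n : nat) :
  \sum_(0 <= k < n) \sum_(0 <= i < k.+1) F i (k - i)%N =
  \sum_(0 <= i < n) \sum_(0 <= j < n - i) F i j.
Proof.
elim: n => [|n IH]; first by rewrite !big_geq.
rewrite big_nat_recr //= IH [RHS]big_nat_recr //= subSnn big_nat1.
rewrite [X in _ + X = _]big_nat_recr //= subnn addrA -big_split /=.
congr (_ + _); apply: eq_big_nat => i /andP[_ ni].
by rewrite subSn ?big_nat_recr // ltnW.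
Qed.

(** Cauchy product. The product of the two partial sums exceeds the partial sum of the product
    series by the terms with [i, j < n <= i + j], and this excess is shown to tend to 0. *)
Lemma real_analyticM (R : realType) (f g : R -> R) (t : R) :
  real_analytic_at f t -> real_analytic_at g t ->
  real_analytic_at (fun u => f u * g u) t.
Proof.
move=> /real_analytic_bounded[a [r [M [r0 aM fa]]]].
move=> /real_analytic_bounded[b [s [N [s0 bN gb]]]].
pose c k := \sum_(0 <= i < k.+1) a i * b (k - i)%N.
pose rho := Num.min r s.
have rho0 : 0 < rho by rewrite lt_min r0.
have M0 : 0 <= M by rewrite (le_trans _ (aM 0%N)) // expr0 mulr1.
have N0 : 0 <= N by rewrite (le_trans _ (bN 0%N)) // expr0 mulr1.
(* With [|w| < rho / 8] each excess term is at most [M * N * 8^-n]. There are at most [n^2] of them;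
   since [8 = 2 * 2 * 2], two factors [2^-n] absorb [n^2] through [n * 2^-n <= 1], and the third
   tends to 0. *)
exists c, (rho / 8); split; first by rewrite divr_gt0.
move=> u; set w := u - t => wr.
have [rr rs] : rho <= r /\ rho <= s by rewrite !ge_min !lexx orbT.
have cf := fa u; have cg := gb u; rewrite -/w in cf cg.
have {}cf := cf ltac:(by lra); have {}cg := cg ltac:(by lra).
pose al i := a i * w ^+ i; pose be i := b i * w ^+ i.
have geo (d : nat -> R) (x K : R) : rho <= x ->
    (forall j, `|d j| * x ^+ j <= K) -> forall i, `|d i * w ^+ i| <= K * (8^-1) ^+ i.
  move=> rx dK i; apply: le_trans (_ : `|d i| * x ^+ i * 8^-1 ^+ i <= _).
    rewrite normrM normrX -mulrA -exprMn ler_wpM2l // lerXn2r ?nnegrE //; lra.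
  by rewrite ler_wpM2r // exprn_ge0.
have alM := geo _ _ _ rr aM; have beN := geo _ _ _ rs bN.
have cfg : series al n * series be n @[n --> \oo] --> f u * g u by exact: cvgM.
suff c0 : series al n * series be n - series (fun k => c k * w ^+ k) n
    @[n --> \oo] --> 0.
  rewrite -[f u * g u]subr0; apply: eq_cvgn (cvgB cfg c0) => n /=.
  by rewrite opprB addrC subrK.
apply: norm_cvg0.
apply: (@squeeze_cvgr _ _ _ _ (cst 0) (fun n => M * N * (2^-1) ^+ n)); last 2 first.
- exact: cvg_cst.
- rewrite -[0](mulr0 (M * N)); apply: cvgMr; apply: cvg_expr.
  by rewrite ger0_norm //; lra.
near=> n; rewrite normr_ge0 /=.
have -> : series (fun k => c k * w ^+ k) n =
    \sum_(0 <= i < n) \sum_(0 <= j < n - i) al i * be j.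
  rewrite -sum_triangle /series /=; apply: eq_bigr => k _.
  rewrite /c mulr_suml; apply: eq_big_nat => i /andP[_ ik].
  rewrite /al /be (_ : w ^+ k = w ^+ i * w ^+ (k - i)); first by ring.
  by rewrite -exprD subnKC.
rewrite /series /= mulr_suml -sumrB.
apply: (@le_trans _ _ (\sum_(0 <= i < n) \sum_(0 <= j < n) M * N * 8^-1 ^+ n)).
  apply: le_trans (ler_norm_sum _ _ _) _; apply: ler_sum_nat => i /andP[_ ni].
  rewrite mulr_sumr (@big_cat_nat _ _ _ (n - i)) //= ?leq_subr //.
  rewrite addrAC subrr add0r.
  apply: le_trans (ler_norm_sum _ _ _) _.
  rewrite [leRHS](@big_cat_nat _ _ _ (n - i)) //= ?leq_subr //.
  rewrite -[leLHS]add0r lerD //.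
    by apply: sumr_ge0 => *; rewrite !mulr_ge0 // exprn_ge0.
  apply: ler_sum_nat => j /andP[nij _].
  rewrite normrM; apply: le_trans (ler_pM _ _ (alM i) (beN j)) _ => //.
  rewrite mulrACA -exprD ler_wpM2l ?mulr_ge0 // ler_wiXn2l //; first lra.
  by rewrite -leq_subLR.
rewrite !sumr_const_nat subn0 -[_ *+ n *+ n]mulr_natr -[_ *+ n]mulr_natr.
have n2 : n%:R * 2^-1 ^+ n <= 1 :> R.
  by rewrite exprVn ler_pdivrMr ?exprn_gt0 // mul1r -natrX ler_nat ltnW // ltn_expl.
have -> : (8^-1 : R) = 2^-1 * 2^-1 * 2^-1 by field.
rewrite !exprMn; set e := 2^-1 ^+ n in n2 *.
have e0 : 0 <= e by rewrite exprn_ge0.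
have -> : M * N * (e * e * e) * n%:R * n%:R = M * N * (e * (n%:R * e * (n%:R * e))).
  by ring.
by rewrite ler_wpM2l ?mulr_ge0 // ler_piMr // mulr_ile1 // mulr_ge0.
Unshelve. all: by end_near. Qed.

Lemma real_analytic_expR (R : realType) (c t : R) :
  real_analytic_at (fun u => expR (c * u)) t.
Proof.
exists (fun k => expR (c * t) * (c ^+ k / k`!%:R)), 1; split => // u _.
have -> : expR (c * u) = expR (c * t) * expR (c * (u - t)).
  by rewrite -expRD; congr expR; ring.
have : series (exp_coeff (c * (u - t))) @ \oo --> expR (c * (u - t)).
  exact: is_cvg_series_exp_coeff.
move=> ce; apply: eq_cvgn (cvgM (cvg_cst (expR (c * t))) ce) => n.
rewrite /series /= mulr_sumr; apply: eq_bigr => k _.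
by rewrite /exp_coeff /= exprMn; ring.
Qed.

Lemma real_analytic_lipschitz (R : realType) (f : R -> R) (t : R) :
  real_analytic_at f t ->
  exists (d K : R), 0 < d /\ forall u, `|u - t| <= d -> `|f u - f t| <= K * `|u - t|.
Proof.
move=> /real_analytic_bounded[a [r [M [r0 aM fa]]]].
have d0 : 0 < r / 2 by rewrite divr_gt0.
have near0 u : `|u - t| <= r / 2 -> `|f u - a 0%N| <= 2 * M * (`|u - t| / r).
  move=> ut; have := @power_series_tail _ a M r (u - t) (f u) 1 r0 aM ut.
  rewrite big_nat1 expr0 mulr1 expr1; apply; apply: fa; lra.
exists (r / 2), (2 * M / r); split => // u ut.
(* The estimate at [u = t] itself bounds [|f t - a 0|] by 0. *)
have -> : f t = a 0%N.
  apply/eqP; rewrite -subr_eq0 -normr_le0.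
  by have := near0 t; rewrite subrr normr0 mul0r mulr0; apply; rewrite ltW.
by rewrite mulrAC -mulrA; exact: near0.
Qed.

(** One-sided vanishing kills the coefficients one by one. If those before [a k] are 0, the tail
    estimate of order [k + 1] at [t + w], where [f] is 0, gives [|a k| * r^(k+1) <= 2 * M * w]; then
    [w] tends to 0. *)
Lemma real_analytic_zero (R : realType) (f : R -> R) (t e : R) :
  real_analytic_at f t -> 0 < e -> (forall u, t < u < t + e -> f u = 0) ->
  exists d : R, 0 < d /\ forall u, `|u - t| < d -> f u = 0.
Proof.
move=> /real_analytic_bounded[a [r [M [r0 aM fa]]]] e0 f0.
have M0 : 0 <= M by rewrite (le_trans _ (aM 0%N)) // expr0 mulr1.
suff a0 k : a k = 0.
  exists r; split => // u /ltW /fa /cvgn_unique; apply.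
  apply: (@eq_cvgn _ (cst 0)) (cvg_cst _) => n.
  rewrite /series /= big1 // => i _.
  by rewrite a0 mul0r.
elim/ltn_ind: k => k IH; apply/eqP; rewrite -normr_le0.
have bnd (w : R) : 0 < w -> w < e -> w <= r / 2 -> `|a k| * r ^+ k.+1 <= 2 * M * w.
  move=> w0 we wr.
  have := @power_series_tail _ a M r w 0 k.+1 r0 aM.
  rewrite (gtr0_norm w0) => /(_ wr).
  have tw : f (t + w) = 0 by apply: f0; rewrite ltrDl w0 ltrD2l.
  have := fa (t + w); rewrite tw addrAC subrr add0r.
  rewrite (gtr0_norm w0) => /(_ ltac:(lra)) cw /(_ cw).
  rewrite sub0r normrN big_nat_recr //= big_nat big1 ?add0r; last first.
    by move=> i /andP[_ /IH ->]; rewrite mul0r.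
  rewrite normrM normrX (gtr0_norm w0) expr_div_n mulrA ler_pdivlMr ?exprn_gt0 //.
  by rewrite mulrAC [w ^+ k.+1]exprS mulrA ler_pM2r ?exprn_gt0.
have rk : 0 < r ^+ k.+1 by rewrite exprn_gt0.
rewrite -(@ler_pM2r _ (r ^+ k.+1)) // mul0r; apply/ler_addgt0Pr => eps eps0.
rewrite add0r.
(* The three bounds keep [t + w] in the zero interval, allow the tail estimate, and give
   [2 * M * w <= eps]; the [+ 1] covers [M = 0]. *)
pose w := Num.min (Num.min (e / 2) (r / 2)) (eps / (2 * M + 1)).
have w0 : 0 < w by rewrite !lt_min !divr_gt0 //; lra.
have [w1 [w2 w3]] : w <= e / 2 /\ w <= r / 2 /\ w <= eps / (2 * M + 1).
  by rewrite !ge_min !lexx !orbT.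
apply: le_trans (bnd w w0 _ w2) _; first by lra.
move: w3; rewrite ler_pdivlMr; last by lra.
by nra.
Qed.

(** If the difference [h] were nonzero at some [t > 0], the infimum of the points beyond which [h]
    vanishes would be at least [t]. But [h] vanishes to the right of this infimum, hence around it,
    so the infimum could be lowered. *)
Lemma real_analytic_identity (R : realType) (f g : R -> R) :
  (forall t : R, 0 < t -> real_analytic_at f t) ->
  (forall t : R, 0 < t -> real_analytic_at g t) ->
  (forall t : R, 1 < t -> f t = g t) -> forall t : R, 0 < t -> f t = g t.
Proof.
move=> fan gan fg.
pose h u := f u + (-1) * g u.
have han (t : R) : 0 < t -> real_analytic_at h t.
  move=> t0; apply: real_analyticD; first exact: fan.
  by apply: real_analyticM; [exact: real_analytic_cst | exact: gan].
suff h0 (t : R) : 0 < t -> h t = 0.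
  by move=> t t0; have := h0 t t0; rewrite /h mulN1r => /subr0_eq.
move=> t0; apply/eqP/negP => /negP ht.
pose A := [set x : R | 0 < x /\ forall u, x < u -> h u = 0].
have A1 : A 1 by split => // u u1; rewrite /h fg // mulN1r subrr.
have lbt : lbound A t.
  by move=> x [x0 hx]; rewrite leNgt; apply/negP => /hx /eqP; exact/negP.
have hA : has_inf A by split; [exists 1 | exists t].
have tinf : t <= inf A by apply: lb_le_inf => //; exists 1.
have hinf (u : R) : inf A < u -> h u = 0.
  by move=> iu; have [x [_ hx] xu] := inf_lt hA.1 iu; exact: hx.
have i0 : 0 < inf A by exact: lt_le_trans tinf.
have [d [d0 hd]] := @real_analytic_zero _ h (inf A) 1 (han _ i0) ltr01
  ltac:(by move=> u /andP[/hinf]).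
(* Half the minimum keeps [inf A - m] positive and within distance [d] of [inf A]. *)
pose m := Num.min d (inf A) / 2.
have [md mi] : Num.min d (inf A) <= d /\ Num.min d (inf A) <= inf A.
  by rewrite !ge_min !lexx orbT.
have m0 : 0 < Num.min d (inf A) by rewrite lt_min d0.
have : A (inf A - m).
  split; first by rewrite /m; lra.
  move=> u mu; case: (ltP (inf A) u) => [/hinf //|ui].
  by apply: hd; rewrite ler0_norm ?subr_le0 // /m in mu *; lra.
by move/(ge_inf hA.2); rewrite /m; lra.
Qed.

(** * Complex powers *)

Lemma cexpD (R : realType) (z w : R[i]) : cexp (z + w) = cexp z * cexp w.
Proof.
case: z w => [a b] [c d]; rewrite /cexp /= expRD cosD sinD; simpc.
by congr (_ +i* _); ring.
Qed.

Lemma cpowD (R : realType) (x : R) (z w : R[i]) :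
  cpow x (z + w) = cpow x z * cpow x w.
Proof. by rewrite /cpow mulrDl cexpD. Qed.

Lemma cpowM (R : realType) (x y : R) (z : R[i]) : 0 < x -> 0 < y ->
  cpow (x * y) z = cpow x z * cpow y z.
Proof. by move=> x0 y0; rewrite /cpow lnM ?posrE // rmorphD /= mulrDr cexpD. Qed.

Lemma cpow1 (R : realType) (z : R[i]) : cpow (1 : R) z = 1.
Proof. by rewrite /cpow ln1 mulr0 /cexp /= expR0 cos0 sin0 mul1r. Qed.

Lemma cpowE (R : realType) (x : R) (z : R[i]) :
  cpow x z = (expR (Re z * ln x) * cos (Im z * ln x)) +i*
             (expR (Re z * ln x) * sin (Im z * ln x)).
Proof. by case: z => a b; rewrite /cpow /cexp /=; simpc. Qed.

Lemma Re_cpow (R : realType) (c z : R[i]) (x : R) :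
  Re (c * cpow x z) =
  expR (Re z * ln x) * (Re c * cos (Im z * ln x) - Im c * sin (Im z * ln x)).
Proof. by rewrite cpowE; case: c => c d /=; ring. Qed.

Lemma norm_Re_cpow_le (R : realType) (c z : R[i]) (x : R) :
  `|Re (c * cpow x z)| <= (`|Re c| + `|Im c|) * expR (Re z * ln x).
Proof.
rewrite Re_cpow normrM ger0_norm ?expR_ge0 // mulrC ler_wpM2r ?expR_ge0 //.
apply: le_trans (ler_normB _ _) _; rewrite !normrM lerD // ler_piMr //.
  by rewrite ler_norml cos_geN1 cos_le1.
by rewrite ler_norml sin_geN1 sin_le1.
Qed.

Lemma measurable_Re_cpow (R : realType) (c z : R[i]) :
  measurable_fun [set: R] (fun x : R => Re (c * cpow x z)).
Proof.
under eq_fun do rewrite Re_cpow.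
have mln (k : R) : measurable_fun [set: R] (fun x : R => k * ln x).
  by apply: measurable_funM => //; exact: measurable_cst.
apply: measurable_funM.
  by apply: measurableT_comp (mln _); exact: measurable_expR.
apply: measurable_funB; apply: measurable_funM; try exact: measurable_cst.
- apply: measurableT_comp (mln _).
  by apply: continuous_measurable_fun; exact: continuous_cos.
- apply: measurableT_comp (mln _).
  by apply: continuous_measurable_fun; exact: continuous_sin.
Qed.

Lemma is_derive_Re_cpow (R : realType) (c z : R[i]) (x : R) : 0 < x ->
  is_derive x 1 (fun x : R => Re (c * cpow x z)) (Re (c * z * cpow x (z - 1))).
Proof.
move=> x0.
have dl (k : R) : is_derive x 1 (fun y : R => k * ln y) (k * x^-1).
  have := @is_deriveZ _ _ _ (@ln R) k x 1 x^-1 (is_derive1_ln x0).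
  by congr (is_derive _ _ _ _).
have dx : is_derive x 1 (fun y : R => expR (Re z * ln y))
    (expR (Re z * ln x) * (Re z * x^-1)).
  by apply: (@is_derive1_comp _ (@expR R) (fun y => Re z * ln y)).
have dc : is_derive x 1 (fun y : R => cos (Im z * ln y))
    (- sin (Im z * ln x) * (Im z * x^-1)).
  by apply: (@is_derive1_comp _ (@cos R) (fun y => Im z * ln y)).
have ds : is_derive x 1 (fun y : R => sin (Im z * ln y))
    (cos (Im z * ln x) * (Im z * x^-1)).
  by apply: (@is_derive1_comp _ (@sin R) (fun y => Im z * ln y)).
rewrite (_ : (fun _ => _) = (fun y : R => expR (Re z * ln y)) *
  (Re c *: (fun y : R => cos (Im z * ln y)) -
   Im c *: (fun y : R => sin (Im z * ln y)))); last first.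
  by apply/funext => y; rewrite Re_cpow.
apply: is_derive_eq.
rewrite Re_cpow.
have -> : expR (Re (z - 1) * ln x) = expR (Re z * ln x) * x^-1.
  have -> : Re (z - 1) = Re z - 1 by case: (z).
  by rewrite mulrBl expRB mul1r lnK.
have -> : Im (z - 1) = Im z by case: (z) => a b /=; rewrite subr0.
have -> : Re (c * z) = Re c * Re z - Im c * Im z by case: (c) (z) => ? ? [].
have -> : Im (c * z) = Re c * Im z + Im c * Re z.
  by case: (c) (z) => ? ? [? ?] /=.
rewrite (_ : (_ - _ : R -> R) x = Re c * cos (Im z * ln x) - Im c * sin (Im z * ln x)) //.
by rewrite /GRing.scale /=; ring.
Qed.

Lemma continuous_Re_cpow (R : realType) (c z : R[i]) (x : R) : 0 < x ->
  {for x, continuous (fun x : R => Re (c * cpow x z))}.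
Proof.
move=> /(is_derive_Re_cpow c z) d.
by apply/differentiable_continuous/derivable1_diffP; exact: ex_derive.
Qed.

Lemma integral_Re_cpow (R : realType) (c s : R[i]) (a b : R) :
  s != 0 -> 0 < a -> a < b ->
  (\int[@lebesgue_measure R]_(x in `[a, b[) (Re (c * cpow x (- s - 1)))%:E =
   (Re (c / s * (cpow a (- s) - cpow b (- s))))%:E)%E.
Proof.
move=> s0 a0 ab.
rewrite integral_itv_bndo_bndc; last first.
  by apply/measurable_EFinP; apply: measurable_funTS; exact: measurable_Re_cpow.
(* An antiderivative of the integrand, by the power rule [is_derive_Re_cpow]. *)
pose F (x : R) := Re (- c / s * cpow x (- s)).
have dF (x : R) : 0 < x -> is_derive x 1 F (Re (c * cpow x (- s - 1))).
  move=> x0; have := is_derive_Re_cpow (- c / s) (- s) x0.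
  by have -> : - c / s * - s = c by rewrite mulNr mulrNN divfK.
have cF (x : R) : 0 < x -> {for x, continuous F}.
  by move=> x0; exact: continuous_Re_cpow.
rewrite (@continuous_FTC2 _ _ F) //.
- by rewrite -EFinB /F -raddfB /= mulrBr !mulNr opprK addrC.
- apply: continuous_in_subspaceT => x; rewrite inE /= in_itv /= => /andP[ax _].
  by apply: continuous_Re_cpow; exact: lt_le_trans ax.
- split.
  + move=> x; rewrite in_itv /= => /andP[ax _].
    by apply: (@ex_derive _ _ _ _ _ _ _ (dF x _)); exact: lt_trans ax.
  + by apply: cvg_at_right_filter; exact: cF.
  + by apply: cvg_at_left_filter; apply: cF; exact: lt_trans ab.
- move=> x; rewrite in_itv /= => /andP[ax _].
  by rewrite derive1E; have [_ ->] := dF x (lt_trans a0 ax).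
Qed.

Lemma expR_ln_cvg0 (R : realType) (t : R) : 0 < t ->
  expR (- t * ln x) @[x --> +oo] --> 0.
Proof.
move=> t0; apply/cvgrPdist_lt => e e0; near=> x.
have x0 : 0 < x by near: x; apply: nbhs_pinfty_gt; exact: num_real.
rewrite sub0r normrN ger0_norm ?expR_ge0 //.
rewrite -[ltRHS]lnK ?posrE // ltr_expR mulNr ltrNl -ltr_pdivrMl //.
by rewrite -[ltLHS]expRK ltr_ln ?posrE ?expR_gt0.
Unshelve. all: by end_near. Qed.

(** The power [x^(-1-t)] has the antiderivative [- t^-1 * x^(-t)], which vanishes at infinity. Its
    multiples are the majorants in every dominated convergence argument below. *)
Lemma integrable_expR_ln (R : realType) (t : R) : 0 < t ->
  (@lebesgue_measure R).-integrable `[1, +oo[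
    (fun x => (expR ((- 1 - t) * ln x))%:E).
Proof.
move=> t0.
have E (k : R) x : expR (k * ln x) = Re (1 * cpow x k%:C).
  by rewrite Re_cpow /= !mul0r cos0 mul1r subr0 mulr1.
have mE : measurable_fun [set: R] (fun x : R => expR ((- 1 - t) * ln x)).
  by under eq_fun do rewrite E; exact: measurable_Re_cpow.
apply/integrableP; split.
  by apply: measurable_funTS; apply/measurable_EFinP.
under eq_integral do rewrite gee0_abs ?lee_fin ?expR_ge0 //.
pose F (x : R) := - t^-1 * expR (- t * ln x).
have dF (x : R) : 0 < x -> is_derive x 1 F (expR ((- 1 - t) * ln x)).
  move=> x0; have := is_derive_Re_cpow (- t^-1)%:C (- t)%:C x0.
  rewrite -rmorphM mulNr mulrN opprK mulVf ?gt_eqF //.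
  rewrite (_ : (- t)%:C - 1 = (- 1 - t)%:C); last first.
    by rewrite -[1 in LHS]/(1%:C) -rmorphB /=; congr (_%:C); ring.
  rewrite -E; congr (is_derive _ _ _ _); apply/funext => y.
  by rewrite /F E mul1r cpowE; simpc.
have cF (x : R) : 0 < x -> {for x, continuous F}.
  move=> x0; apply/differentiable_continuous/derivable1_diffP.
  exact: (@ex_derive _ _ _ _ _ _ _ (dF x x0)).
rewrite (@ge0_continuous_FTC2y _ _ F _ 0) ?ltry //.
- apply: continuous_in_subspaceT => x; rewrite inE /= in_itv /= andbT => x1.
  rewrite (_ : (fun _ => _) = fun y : R => Re (1 * cpow y (- 1 - t)%:C)).
    by apply: continuous_Re_cpow; exact: lt_le_trans x1.
  by apply/funext => y; rewrite E.
- rewrite -(mulr0 (- t^-1)); apply: cvgM; first exact: cvg_cst.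
  exact: expR_ln_cvg0.
- by move=> x x1; apply: (@ex_derive _ _ _ _ _ _ _ (dF x _)); exact: lt_trans x1.
- by apply: cvg_at_right_filter; exact: cF.
- move=> x; rewrite in_itv /= andbT => x1.
  by rewrite derive1E; have [_ ->] := dF x (lt_trans ltr01 x1).
Qed.

(** * The Mellin transform of the odd-integer-part indicator *)

Lemma Rintegral_dominated (R : realType) (D : set R) (f_ : nat -> R -> R)
    (f g : R -> R) :
  measurable D -> (forall n, measurable_fun D (f_ n)) ->
  (forall x, D x -> f_ n x @[n --> \oo] --> f x) ->
  mu.-integrable D (EFin \o g) -> (forall n x, D x -> `|f_ n x| <= g x) ->
  mu.-integrable D (EFin \o f) /\
  \int[mu]_(x in D) f_ n x @[n --> \oo] --> \int[mu]_(x in D) f x.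
Proof.
move=> mD mf_ f_f ig f_g.
have mf : measurable_fun D f by apply: (measurable_fun_cvg mf_).
have [] := @dominated_convergence _ _ _ mu D mD (fun n => EFin \o f_ n)
  (EFin \o f) (EFin \o g).
- by move=> n; apply/measurable_EFinP; exact: mf_.
- by apply/measurable_EFinP; exact: mf.
- apply: aeW => x Dx; apply: cvg_EFin; first by apply: nearW.
  exact: f_f.
- by [].
- by apply: aeW => x n Dx /=; rewrite lee_fin f_g.
move=> intf _ cf; split => //.
have intf_fin : (\int[mu]_(x in D) (f x)%:E)%E \is a fin_num.
  by apply: integrable_fin_num; [exact: mD | exact: intf].
rewrite /Rintegral; apply: fine_cvg.
by rewrite fineK.
Qed.

Lemma Rintegral_series (R : realType) (D : set R) (f : nat -> R -> R) (n : nat) :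
  measurable D -> (forall m, mu.-integrable D (EFin \o f m)) ->
  mu.-integrable D (EFin \o (fun x => series (f ^~ x) n)) /\
  \int[mu]_(x in D) series (f ^~ x) n = series (fun m => \int[mu]_(x in D) f m x) n.
Proof.
move=> mD intf; rewrite /series /=; elim: n => [|n [intS IH]].
  rewrite big_geq //; split.
    by under eq_fun do rewrite big_geq //; exact: integrable0.
  by under eq_Rintegral do rewrite big_geq //; rewrite Rintegral_cst // mul0r.
rewrite big_nat_recr //= -IH -RintegralD //; split.
  rewrite (_ : EFin \o _ = (EFin \o (fun x => \sum_(0 <= k < n) f k x)) \+
    (EFin \o f n)); first exact: integrableD.
  by apply/funext => x /=; rewrite big_nat_recr.
by apply: eq_Rintegral => x _; rewrite big_nat_recr.
Qed.

Lemma integrable_bounded_cpow (R : realType) (w : R -> R) (c s : R[i]) :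
  measurable_fun setT w -> (forall x, `|w x| <= 1) -> 0 < Re s ->
  mu.-integrable `[1, +oo[ (EFin \o (fun x => w x * Re (c * cpow x (- s - 1)))).
Proof.
move=> mw w1 s0.
have := integrable_expR_ln s0.
move=> /(@integrableZl _ _ _ mu _ (measurable_itv `[1, +oo[) (`|Re c| + `|Im c|) _).
apply: le_integrable => //.
  apply/measurable_EFinP; apply: measurable_funTS; apply: measurable_funM => //.
  exact: measurable_Re_cpow.
move=> x _ /=; rewrite lee_fin normrM.
apply: le_trans (ler_piMl _ (w1 x)) _ => //.
apply: le_trans (norm_Re_cpow_le _ _ _) _.
have -> : Re (- s - 1) = - 1 - Re s by case: (s) => a b /=; rewrite addrC.
exact: ler_norm.
Qed.

Lemma Re_cintegral (R : realType) (D : set R) (f : R -> R[i]) (c : R[i]) :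
  measurable D -> cintegrable D f ->
  \int[mu]_(x in D) Re (c * f x) = Re (c * cintegral D f).
Proof.
move=> mD [fr fi]; rewrite /cintegral.
have -> : Re (c * (\int[mu]_(x in D) Re (f x) +i* \int[mu]_(x in D) Im (f x))) =
  Re c * \int[mu]_(x in D) Re (f x) - Im c * \int[mu]_(x in D) Im (f x) by case: c.
rewrite -!RintegralZl // -RintegralB //.
- by apply: eq_Rintegral => x _; case: c (f x) => ? ? [].
- exact: (integrableZl _ (Re c) fr).
- exact: (integrableZl _ (Im c) fi).
Qed.

(** The interval of [chi m.+1]: [chi] is summed from 1, while [series] starts at 0. *)
Definition odd_block (R : realType) (m : nat) : set R :=
  `[2 * m.+1%:R - 1, 2 * m.+1%:R[.

Arguments odd_block R m : clear implicits.

Definition odd_floor (R : realType) : set R := \bigcup_m odd_block R m.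

Arguments odd_floor R : clear implicits.

Lemma trivIset_odd_block (R : realType) : trivIset [set: nat] (odd_block R).
Proof.
have H i j x : (i < j)%N -> odd_block R i x -> ~ odd_block R j x.
  move=> ij; rewrite /odd_block /= !in_itv /= => /andP[_ xi] /andP[jx _].
  have : (i.+2%:R : R) <= j.+1%:R by rewrite ler_nat.
  by move: xi jx; rewrite -(natr1 i.+1); lra.
apply/trivIsetP => i j _ _ /eqP ij; rewrite -subset0 => x [xi xj].
move: ij; case: (ltngtP i j) => // h _.
  exact: H h xi xj.
exact: H h xj xi.
Qed.

Lemma measurable_odd_block (R : realType) (m : nat) : measurable (odd_block R m).
Proof. exact: measurable_itv. Qed.

Lemma measurable_odd_floor (R : realType) : measurable (odd_floor R).
Proof. by apply: bigcup_measurable => m _; exact: measurable_odd_block. Qed.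

(** The blocks are disjoint, so their indicators add up to that of the union; the extended-real
    identity [indic_bigcup] is brought back to real numbers. *)
Lemma cvg_indic_odd_block (R : realType) (v : R) :
  series (fun m => \1_(odd_block R m) v) @ \oo --> (\1_(odd_floor R) v : R).
Proof.
have := @is_cvg_nneseries R (fun m => (\1_(odd_block R m) v)%:E) xpredT 0.
move=> /(_ (fun _ _ _ => ltac:(by rewrite lee_fin))).
move/cvg_ex => [l cl].
have El : l = (\1_(odd_floor R) v)%:E.
  rewrite indic_bigcup; last exact: trivIset_odd_block.
  by apply/esym; exact: cvg_lim cl.
move: cl; rewrite El => /fine_cvg; apply: eq_cvgn => n /=.
by rewrite sumEFin.
Qed.

Lemma measurable_indic_div (R : realType) (A : set R) (u : R) :
  measurable A -> measurable_fun setT (fun x : R => \1_A (x / u) : R).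
Proof.
move=> mA; apply: (measurableT_comp (measurable_indic mA)).
apply: measurable_funM => //; exact: measurable_cst.
Qed.

Lemma norm_indic_le1 (R : realType) (A : set R) (x : R) : `|\1_A x : R| <= 1.
Proof. by rewrite indicE; case: (_ \in _); rewrite ?normr1 ?normr0. Qed.

(** The indicator cuts out the block scaled by [u], which lies inside [[1, +oo[] because [u >= 1];
    the power is then integrated exactly. *)
Lemma Rintegral_odd_block (R : realType) (u : R) (c s : R[i]) (m : nat) :
  1 <= u -> s != 0 ->
  \int[mu]_(x in `[1, +oo[)
    (\1_(odd_block R m) (x / u) * Re (c * cpow x (- s - 1))) =
  Re (c / s * cpow u (- s) *
      (cpow (2 * m.+1%:R - 1 : R) (- s) - cpow (2 * m.+1%:R : R) (- s))).
Proof.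
move=> u1 s0; have u0 : 0 < u by exact: lt_le_trans u1.
have m1 : (1 : R) <= m.+1%:R by rewrite ler1n.
pose B : set R := `[(2 * m.+1%:R - 1) * u, 2 * m.+1%:R * u[%classic.
transitivity (\int[mu]_(x in `[1, +oo[ `&` B) Re (c * cpow x (- s - 1))).
  rewrite Rintegral_mkcondr; apply: eq_Rintegral => x _.
  rewrite patchE indicE.
  have -> : (x / u \in odd_block R m) = (x \in B).
    apply/idP/idP; rewrite !inE /odd_block /B /= !in_itv /=;
    by rewrite ler_pdivlMr // ltr_pdivrMr.
  by case: (_ \in _); rewrite ?mul1r ?mul0r.
have -> : `[1, +oo[ `&` B = B.
  apply/setIidr => x; rewrite /B /= !in_itv /= andbT => /andP[h _].
  apply: le_trans h; nra.
rewrite /Rintegral integral_Re_cpow //=; last 2 first.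
- nra.
- by rewrite ltr_pM2r //; lra.
have a0 : 0 < 2 * m.+1%:R - 1 :> R by lra.
have b0 : 0 < 2 * m.+1%:R :> R by lra.
by rewrite (cpowM _ a0 u0) (cpowM _ b0 u0) -mulrBl mulrA mulrAC.
Qed.

(** Dominated convergence sums the block integrals. A general [u >= 1] is kept because the inner
    integrals of the Fubini argument involve [x / u]. *)
Lemma cvg_odd_floor_mellin (R : realType) (u : R) (c s : R[i]) :
  1 <= u -> 0 < Re s ->
  series (fun m => Re (c / s * cpow u (- s) *
      (cpow (2 * m.+1%:R - 1 : R) (- s) - cpow (2 * m.+1%:R : R) (- s)))) @ \oo -->
  \int[mu]_(x in `[1, +oo[)
    (\1_(odd_floor R) (x / u) * Re (c * cpow x (- s - 1))).
Proof.
move=> u1 s0.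
have sn0 : s != 0 by apply: contraTneq s0 => ->; rewrite ltxx.
pose f m (x : R) := \1_(odd_block R m) (x / u) * Re (c * cpow x (- s - 1)).
have intf m : mu.-integrable `[1, +oo[ (EFin \o f m).
  apply: integrable_bounded_cpow => //; last by move=> x; exact: norm_indic_le1.
  by apply: measurable_indic_div; exact: measurable_odd_block.
have [] := @Rintegral_dominated R `[1, +oo[ (fun n x => series (f ^~ x) n)
  (fun x => \1_(odd_floor R) (x / u) * Re (c * cpow x (- s - 1)))
  (fun x => (`|Re c| + `|Im c|) * expR ((- 1 - Re s) * ln x)).
- exact: measurable_itv.
- move=> n; apply/measurable_EFinP; apply: (measurable_int mu).
  by have [] := Rintegral_series n (measurable_itv `[1, +oo[) intf.
- move=> x _.
  have : series (fun m => \1_(odd_block R m) (x / u)) n * Re (c * cpow x (- s - 1))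
      @[n --> \oo] --> \1_(odd_floor R) (x / u) * Re (c * cpow x (- s - 1)).
    by apply: cvgM; [exact: cvg_indic_odd_block | exact: cvg_cst].
  by apply: eq_cvgn => n; rewrite /series /= mulr_suml.
- exact: (@integrableZl _ _ _ mu _ (measurable_itv `[1, +oo[) (`|Re c| + `|Im c|) _ (integrable_expR_ln s0)).
- move=> n x _.
  rewrite (_ : series _ n = series (fun m => \1_(odd_block R m) (x / u)) n *
    Re (c * cpow x (- s - 1))); last by rewrite /series /= mulr_suml.
  rewrite normrM.
  have S0 : 0 <= series (fun m => \1_(odd_block R m) (x / u) : R) n.
    by apply: sumr_ge0.
  (* The partial sums increase to an indicator, so a single power majorizes all of them. *)
  have S1 : series (fun m => \1_(odd_block R m) (x / u) : R) n <= 1.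
    have cS := @cvg_indic_odd_block R (x / u).
    apply: le_trans (_ : \1_(odd_floor R) (x / u) <= _); last first.
      by apply: le_trans (norm_indic_le1 (odd_floor R) (x / u)); exact: ler_norm.
    rewrite -(cvg_lim _ cS) //; apply: nondecreasing_cvgn_le.
      by apply: nondecreasing_series => *.
    by apply/cvg_ex; eexists; exact: cS.
  rewrite ger0_norm //; apply: le_trans (ler_piMl _ S1) _ => //.
  apply: le_trans (norm_Re_cpow_le _ _ _) _.
  by have -> : Re (- s - 1) = - 1 - Re s by case: (s) => a b /=; rewrite addrC.
move=> _; apply: eq_cvgn => n.
have [_ ->] := Rintegral_series n (measurable_itv `[1, +oo[) intf.
by apply: eq_bigr => m _; exact: Rintegral_odd_block.
Qed.

(** The function [K] of the opening overview. *)
Definition odd_floor_mellin (R : realType) (s : R[i]) : R[i] :=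
  cintegral `[1, +oo[ (fun x : R => (\1_(odd_floor R) x)%:C * cpow x (- s - 1)).

Lemma cintegrable_odd_floor (R : realType) (s : R[i]) : 0 < Re s ->
  cintegrable `[1, +oo[ (fun x : R => (\1_(odd_floor R) x)%:C * cpow x (- s - 1)).
Proof.
move=> s0.
have H c := @integrable_bounded_cpow R (\1_(odd_floor R)) c s
  (measurable_indic (@measurable_odd_floor R)) (norm_indic_le1 (odd_floor R)) s0.
split.
- have := H 1; congr (_.-integrable _ _); apply/funext => x; rewrite /comp.
  by move: (cpow x _) => [a b] /=; congr EFin; ring.
- have := H (- 'i); congr (_.-integrable _ _); apply/funext => x; rewrite /comp.
  by move: (cpow x _) => [a b] /=; congr EFin; ring.
Qed.

(** The scaling rule for the substitution [x = u * y], obtained from uniqueness of limits: the block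
    series for [u] and [c] is also the one for [1] and [c * u^(-s)]. *)
Lemma Rintegral_odd_floor_div (R : realType) (u : R) (c s : R[i]) :
  1 <= u -> 0 < Re s ->
  \int[mu]_(x in `[1, +oo[) (\1_(odd_floor R) (x / u) * Re (c * cpow x (- s - 1))) =
  Re (c * cpow u (- s) * odd_floor_mellin s).
Proof.
move=> u1 s0.
apply: (cvgn_unique (@cvg_odd_floor_mellin R u c s u1 s0)).
have := @cvg_odd_floor_mellin R 1 (c * cpow u (- s)) s (lexx 1) s0.
rewrite cpow1 mulr1 -Re_cintegral //; last exact: cintegrable_odd_floor.
rewrite [c * _ / s]mulrAC; congr (_ --> _).
apply: eq_Rintegral => x _; rewrite divr1.
by move: (c * _) (cpow x _) => [a b] [d e] /=; ring.
Qed.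

(** The case [u = 1] with [c * s] in place of [c], which cancels the division by [s] and leaves the
    alternating zeta series grouped in pairs. *)
Lemma cvg_eta_odd_floor_mellin (R : realType) (c s : R[i]) : 0 < Re s ->
  series (fun m => Re (c * (cpow (2 * m.+1%:R - 1 : R) (- s) -
                            cpow (2 * m.+1%:R : R) (- s)))) @ \oo -->
  Re (c * (s * odd_floor_mellin s)).
Proof.
move=> s0; have sn0 : s != 0 by apply: contraTneq s0 => ->; rewrite ltxx.
have := @cvg_odd_floor_mellin R 1 (c * s) s (lexx 1) s0.
by rewrite Rintegral_odd_floor_div // cpow1 !mulr1 mulfK // -mulrA.
Qed.

(** * The Mellin transform of [phi] *)

Lemma expRN_ln (R : realType) (u : R) : 0 < u -> expR (- ln u) = u^-1.
Proof. by move=> u0; rewrite expRN lnK. Qed.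

Lemma measurable_expRN_ln (R : realType) :
  measurable_fun setT (fun u : R => expR (- ln u)).
Proof.
apply: (measurableT_comp (@measurable_expR R)).
exact: (measurableT_comp _ (@measurable_ln R)).
Qed.

(* [u^-1] is written [expR (- ln u)], which is measurable on the whole line. *)
Definition odd_kernel (R : realType) (x u : R) : R :=
  \1_(odd_floor R) (x * expR (- ln u)) * (\1_(odd_floor R) u * expR (- ln u)).

Lemma nneseries_odd_block (R : realType) (v k : R) : 0 <= k ->
  (\sum_(0 <= n <oo) (\1_(odd_block R n) v * k)%:E = (\1_(odd_floor R) v * k)%:E)%E.
Proof.
move=> k0; under eq_eseriesr do rewrite mulrC EFinM.
rewrite nneseriesZl; last by move=> i _; rewrite lee_fin.
by rewrite mulrC EFinM indic_bigcup //; exact: trivIset_odd_block.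
Qed.

Lemma odd_floor_ge1 (R : realType) (x : R) : odd_floor R x -> 1 <= x.
Proof.
move=> [m _]; rewrite /odd_block /= in_itv /= => /andP[+ _]; apply: le_trans.
have : (1 : R) <= m.+1%:R by rewrite ler1n.
lra.
Qed.

(** Here [x / u < 1] lies below every block. Hence the integral over [[1, x]] in [phi] may be
    extended to [[1, +oo[]. *)
Lemma odd_kernel_gt (R : realType) (x u : R) : 0 < u -> x < u -> odd_kernel x u = 0.
Proof.
move=> u0 xu; rewrite /odd_kernel indicE memNset ?mul0r //.
by move=> /odd_floor_ge1; rewrite expRN_ln // ler_pdivlMr // mul1r leNgt xu.
Qed.

Lemma odd_kernel_ge0 (R : realType) (x u : R) : 0 <= odd_kernel x u.
Proof. by rewrite /odd_kernel !mulr_ge0 // expR_ge0. Qed.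

Lemma measurable_odd_kernel (R : realType) :
  measurable_fun setT (fun z : R * R => odd_kernel z.1 z.2).
Proof.
have m2 : measurable_fun setT (fun z : R * R => expR (- ln z.2)).
  exact: (measurableT_comp (@measurable_expRN_ln R) measurable_snd).
have mo : measurable_fun [set: R] (\1_(odd_floor R) : R -> R).
  by apply: measurable_indic; exact: measurable_odd_floor.
apply: measurable_funM.
  apply: (measurableT_comp mo); apply: measurable_funM => //.
apply: measurable_funM => //.
by apply: (measurableT_comp mo).
Qed.

(** The kernel is at most [1 / u] and vanishes for [u > x]; for [1 <= u <= x] one has [u <= x^2], so
    [1 / u <= x^2 / u^2]. *)
Lemma integrable_odd_kernel (R : realType) (x : R) : 1 <= x ->
  mu.-integrable `[1, +oo[ (EFin \o odd_kernel x).
Proof.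
move=> x1.
have mk : measurable_fun setT (odd_kernel x).
  exact: (measurableT_comp (@measurable_odd_kernel R) (measurable_pair1 x)).
have := @integrableZl _ _ _ mu _ (measurable_itv `[1, +oo[) (x ^+ 2) _
  (integrable_expR_ln ltr01).
apply: le_integrable => //.
  by apply/measurable_EFinP; apply: measurable_funTS.
move=> u /=; rewrite in_itv /= andbT => u1; rewrite lee_fin.
have u0 : 0 < u by exact: lt_le_trans u1.
have x0 : 0 <= x by exact: le_trans x1.
rewrite !ger0_norm ?odd_kernel_ge0 ?mulr_ge0 ?expR_ge0 ?exprn_ge0 //.
have [xu|ux] := ltP x u.
  by rewrite odd_kernel_gt // mulr_ge0 ?expR_ge0 ?exprn_ge0.
rewrite /odd_kernel; apply: (@le_trans _ _ (expR (- ln u))).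
  by rewrite mulrA ler_piMl ?expR_ge0.
rewrite (_ : (- 1 - 1) * ln u = - ln u - ln u); last by ring.
rewrite expRD mulrA ler_peMl ?expR_ge0 // expRN_ln // ler_pdivlMr // mul1r.
by rewrite (le_trans ux) // expr2 ler_peMl // (le_trans _ x1).
Qed.

(** All terms are nonnegative, so the sum over [n] and then the sum over [m] move inside the
    integral, after both indices are shifted to start at 0. *)
Lemma phiE (R : realType) (x : R) : 1 <= x ->
  phi x = \int[mu]_(u in `[1, +oo[) odd_kernel x u.
Proof.
move=> x1; rewrite /phi /Rintegral; congr fine.
have mI := measurable_itv `[(1 : R), x].
have chi_ge0 m (v : R) : 0 <= chi m v by [].
have mx (u : R) : 1 <= u -> u^-1 = expR (- ln u).
  by move=> u1; rewrite expRN_ln // (lt_le_trans _ u1).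
have I_ge0 m n : (0 <= \int[mu]_(u in `[1%R, x]) (chi m (x / u) * chi n u / u)%:E)%E.
  apply: integral_ge0 => u /=; rewrite in_itv /= => /andP[u1 _].
  by rewrite lee_fin !mulr_ge0 // invr_ge0 (le_trans _ u1).
have mo (A : set R) (f : R -> R) : measurable A -> measurable_fun setT f ->
    measurable_fun setT (fun u => \1_A (f u) : R).
  by move=> mA mf; exact: (measurableT_comp (measurable_indic mA) mf).
have me : measurable_fun setT (fun u : R => expR (- ln u)).
  exact: measurable_expRN_ln.
have mxe : measurable_fun setT (fun u : R => x * expR (- ln u)).
  by apply: measurable_funM.
transitivity (\sum_(0 <= m <oo) \sum_(0 <= n <oo) \int[mu]_(u in `[1%R, x])
    (\1_(odd_block R n) u * (\1_(odd_block R m) (x * expR (- ln u)) * expR (- ln u)))%:E)%E.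
  rewrite -nneseries_addn; last by move=> m; apply: nneseries_ge0.
  apply: eq_eseriesr => m _; rewrite -nneseries_addn //.
  apply: eq_eseriesr => n _; rewrite !addn1; apply: eq_integral => u.
  rewrite inE /= in_itv /= => /andP[u1 _].
  by rewrite /chi -/(odd_block R m) -/(odd_block R n) mx // mulrAC mulrC.
transitivity (\sum_(0 <= m <oo) \int[mu]_(u in `[1%R, x])
    (\1_(odd_block R m) (x * expR (- ln u)) * (\1_(odd_floor R) u * expR (- ln u)))%:E)%E.
  apply: eq_eseriesr => m _; rewrite -integral_nneseries //.
  - apply: eq_integral => u _; rewrite nneseries_odd_block ?mulr_ge0 ?expR_ge0 //.
    by congr EFin; ring.
  - move=> n; apply/measurable_EFinP; apply: measurable_funTS.
    apply: measurable_funM; first by apply: measurable_indic; exact: measurable_odd_block.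
    apply: measurable_funM; last exact: me.
    by apply: mo; [exact: measurable_odd_block | exact: mxe].
rewrite -integral_nneseries //; last first.
  move=> n; apply/measurable_EFinP; apply: measurable_funTS.
  apply: measurable_funM.
    by apply: mo; [exact: measurable_odd_block | exact: mxe].
  apply: measurable_funM; last exact: me.
  by apply: measurable_indic; exact: measurable_odd_floor.
transitivity (\int[mu]_(u in `[1%R, +oo[ `&` `[1%R, x]) (odd_kernel x u)%:E)%E.
  rewrite (_ : `[1, +oo[ `&` `[1, x] = `[1, x]%classic :> set R); last first.
    by apply/setIidr => u /=; rewrite !in_itv /= andbT => /andP[].
  apply: eq_integral => u _; rewrite nneseries_odd_block //.
rewrite integral_mkcondr; apply: eq_integral => u; rewrite inE /= in_itv /= andbT => u1.
rewrite patchE; case: ifPn => //; rewrite notin_setE /= in_itv /= u1 /=.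
by move=> /negP; rewrite -ltNge => xu; rewrite odd_kernel_gt // (lt_le_trans _ u1).
Qed.

Lemma Re_cpow_real (R : realType) (x : R) (z : R[i]) : Im z = 0 ->
  Re (1 * cpow x z) = expR (Re z * ln x).
Proof. by move=> z0; rewrite Re_cpow z0 /= !mul0r cos0 mul1r subr0 mulr1. Qed.

(** Turns integrals over [D] into integrals over the line, the form in which Fubini is applied. *)
Lemma restrict_indic (R : realType) (D : set R) (g : R -> R) :
  (EFin \o g) \_ D = (fun x => (\1_D x * g x)%:E).
Proof.
apply/funext => x; rewrite patchE indicE.
by case: (x \in D); rewrite ?mul1r ?mul0r.
Qed.

(** Fubini for the kernel times [Re (c * x^(-s-1))]. Integrating over [u] first gives [phi];
    integrating over [x] first gives, by scaling, the integrand of [K(s)] with [c * K(s)] in place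
    of [c], hence a second factor [K(s)]. *)
Lemma phi_mellin (R : realType) (c s : R[i]) : 0 < Re s ->
  mu.-integrable `[1, +oo[ (EFin \o (fun x => phi x * Re (c * cpow x (- s - 1)))) /\
  \int[mu]_(x in `[1, +oo[) (phi x * Re (c * cpow x (- s - 1))) =
  Re (c * odd_floor_mellin s ^+ 2).
Proof.
move=> s0.
have mD : measurable (`[1, +oo[ : set R) by exact: measurable_itv.
pose D : set R := `[1, +oo[%classic.
pose f (c s : R[i]) (z : R * R) : \bar R :=
  (\1_D z.1 * (\1_D z.2 * (odd_kernel z.1 z.2 * Re (c * cpow z.1 (- s - 1)))))%:E.
have mf c' s' : measurable_fun setT (f c' s').
  apply/measurable_EFinP; apply: measurable_funM.
    exact: (measurableT_comp (measurable_indic mD) measurable_fst).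
  apply: measurable_funM.
    exact: (measurableT_comp (measurable_indic mD) measurable_snd).
  apply: measurable_funM; first exact: measurable_odd_kernel.
  exact: (measurableT_comp (@measurable_Re_cpow R _ _) measurable_fst).
have fG c' s' u : 0 < Re s' -> (\int[mu]_x f c' s' (x, u) =
    (\1_D u * (\1_(odd_floor R) u * Re (c' * odd_floor_mellin s' * cpow u (- s' - 1))))%:E)%E.
  move=> s'0; have [Du|nDu] := pselect (D u); last first.
    rewrite indicE memNset // mul0r integral0_eq // => x _.
    by rewrite /f /= [\1_D u]indicE memNset // mul0r mulr0.
  have u1 : 1 <= u by move: Du; rewrite /D /= in_itv /= andbT.
  have u0 : 0 < u by exact: lt_le_trans u1.
  transitivity (\int[mu]_(x in D) ((\1_(odd_floor R) u * expR (- ln u))%:E *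
      (\1_(odd_floor R) (x / u) * Re (c' * cpow x (- s' - 1)))%:E))%E.
    rewrite [RHS]integral_mkcond; apply: eq_integral => x _.
    rewrite patchE /f /= [\1_D u]indicE mem_set // mul1r indicE.
    case: (x \in D); rewrite ?mul0r // mul1r -EFinM /odd_kernel -expRN_ln //.
    by congr EFin; ring.
  have iw : mu.-integrable D (EFin \o
      (fun x => \1_(odd_floor R) (x / u) * Re (c' * cpow x (- s' - 1)))).
    apply: integrable_bounded_cpow => //; last by move=> x; exact: norm_indic_le1.
    by apply: measurable_indic_div; exact: measurable_odd_floor.
  rewrite integralZl // -[X in (_ * X)%E]fineK; last exact: integrable_fin_num.
  rewrite -/(Rintegral mu D _) Rintegral_odd_floor_div // -EFinM; congr EFin.
  rewrite [\1_D u]indicE mem_set // mul1r -(mulrA (\1_(odd_floor R) u)); congr (_ * _).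
  (* The factor [1 / u] of the kernel and the [u^(-s)] from scaling combine to [u^(-s-1)]. *)
  have cm1 : cpow u (- 1) = (expR (- ln u))%:C.
    by rewrite cpowE /= mulN1r oppr0 mul0r cos0 sin0 mulr1 mulr0.
  rewrite cpowD cm1 mulrA [c' * _ * cpow _ _]mulrAC.
  by move: (c' * _ * _) => [a b] /=; ring.
have fF c' s' x : 0 < Re s' -> (\int[mu]_u f c' s' (x, u) =
    (\1_D x * (phi x * Re (c' * cpow x (- s' - 1))))%:E)%E.
  move=> s'0; have [Dx|nDx] := pselect (D x); last first.
    rewrite indicE memNset // mul0r integral0_eq // => u _.
    by rewrite /f /= indicE memNset // mul0r.
  have x1 : 1 <= x by move: Dx; rewrite /D /= in_itv /= andbT.
  transitivity (\int[mu]_(u in D) ((Re (c' * cpow x (- s' - 1)))%:E *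
      (odd_kernel x u)%:E))%E.
    rewrite [RHS]integral_mkcond; apply: eq_integral => u _.
    rewrite patchE /f /= indicE mem_set // mul1r indicE.
    by case: (u \in D); rewrite ?mul0r // mul1r -EFinM mulrC.
  have ik := integrable_odd_kernel x1.
  rewrite integralZl // -[X in (_ * X)%E]fineK; last exact: integrable_fin_num.
  rewrite -/(Rintegral mu D _) -phiE // -EFinM; congr EFin.
  by rewrite indicE mem_set // mul1r mulrC.
(* For the real exponent [sg] and [c = 1] the integrand is nonnegative, so [fG] computes the
   iterated integral of its absolute value and gives integrability. The general case is dominated by
   a multiple of this one. *)
pose sg : R[i] := (Re s)%:C.
have sg0 : 0 < Re sg by [].
have i1 : (mu \x mu)%E.-integrable setT (f 1 sg).
  apply/integrable21ltyP; first exact: mf.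
  rewrite [X in integral _ _ X](_ : _ = (fun u : R => (\1_D u *
      (\1_(odd_floor R) u *
       Re (1 * odd_floor_mellin sg * cpow u (- sg - 1))))%:E)); last first.
    apply/funext => u; rewrite -fG //; apply: eq_integral => x _.
    rewrite gee0_abs // lee_fin !mulr_ge0 ?odd_kernel_ge0 //.
    by rewrite Re_cpow_real ?expR_ge0 //= subr0 oppr0.
  have iK := @integrable_bounded_cpow R (\1_(odd_floor R)) (1 * odd_floor_mellin sg) sg
    (measurable_indic (@measurable_odd_floor R)) (norm_indic_le1 (odd_floor R)) sg0.
  have : integral mu D (EFin \o (fun u => \1_(odd_floor R) u *
      Re (1 * odd_floor_mellin sg * cpow u (- sg - 1)))) \is a fin_num.
    by apply: integrable_fin_num; [exact: mD | exact: iK].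
  by rewrite integral_mkcond restrict_indic fin_numElt => /andP[].
have ii : (mu \x mu)%E.-integrable setT (f c s).
  have := @integrableZl _ _ _ _ _ measurableT (`|Re c| + `|Im c|) _ i1.
  apply: le_integrable; [exact: measurableT | exact: mf | move=> z _].
  have key : `|\1_D z.1 * (\1_D z.2 * (odd_kernel z.1 z.2 * Re (c * cpow z.1 (- s - 1))))| <=
      `|(`|Re c| + `|Im c|) *
        (\1_D z.1 * (\1_D z.2 * (odd_kernel z.1 z.2 * Re (1 * cpow z.1 (- sg - 1)))))|.
    rewrite 3![(_ + _) * _]mulrCA !normrM !ler_wpM2l //.
    rewrite Re_cpow_real; last by rewrite /= subr0 oppr0.
    rewrite [X in _ <= X * _]ger0_norm ?addr_ge0 // [X in _ <= _ * X]ger0_norm ?expR_ge0 //.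
    rewrite (_ : Re (- sg - 1) = Re (- s - 1)); first exact: norm_Re_cpow_le.
    by rewrite /sg; case: (s) => a b /=.
  by rewrite -lee_fin in key; exact: key.
have iF := integrable_fubini_F ii.
have FG : (\int[mu]_x \int[mu]_u f c s (x, u) = \int[mu]_u \int[mu]_x f c s (x, u))%E.
  exact: Fubini ii.
have EF : (fun x => \int[mu]_u f c s (x, u))%E =
    (fun x => (\1_D x * (phi x * Re (c * cpow x (- s - 1))))%:E).
  by apply/funext => x; rewrite fF.
have EG : (fun u => \int[mu]_x f c s (x, u))%E =
    (fun u => (\1_D u * (\1_(odd_floor R) u *
      Re (c * odd_floor_mellin s * cpow u (- s - 1))))%:E).
  by apply/funext => u; rewrite fG.
split.
  have [_] := @integrable_mkcond _ _ _ mu D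
    (EFin \o (fun x => phi x * Re (c * cpow x (- s - 1)))) mD.
  by apply; rewrite restrict_indic -EF; exact: iF.
rewrite EF EG in FG.
rewrite /Rintegral integral_mkcond restrict_indic FG -restrict_indic -integral_mkcond.
rewrite -/(Rintegral mu D _).
rewrite expr2 mulrA -Re_cintegral //; last exact: cintegrable_odd_floor.
apply: eq_Rintegral => u _.
by move: (c * _) (cpow u _) => [a b] [d e] /=; ring.
Qed.

(** * Continuity, and the zeta function for [Re s > 1] *)

Lemma Re_mul (R : realType) (z w : R[i]) : Re (z * w) = Re z * Re w - Im z * Im w.
Proof. by case: z w => [a b] [c d]. Qed.

Lemma Re_eqM1 (R : realType) (z : R[i]) : Re z = Re (1 * z).
Proof. by rewrite mul1r. Qed.

Lemma Im_eqMNi (R : realType) (z : R[i]) : Im z = Re (- 'i * z).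
Proof. by case: z => a b /=; ring. Qed.

Lemma Re_mulr_real (R : realType) (z : R[i]) (x : R) : Re (z * x%:C) = Re z * x.
Proof. by case: z => a b /=; ring. Qed.

(** A product rule in which only real parts occur, since multiplying by [- 'i] turns an imaginary
    part into a real one. It reduces complex products to real ones for limits and for
    analyticity. *)
Lemma Re_mulM (R : realType) (c z w : R[i]) : Re (c * (z * w)) =
  Re (c * z) * Re (1 * w) - Re (- 'i * c * z) * Re (- 'i * w).
Proof. by rewrite mulrA Re_mul [Im (c * z)]Im_eqMNi [Im w]Im_eqMNi -Re_eqM1 mulrA. Qed.

Lemma complex_eq_Re (R : realType) (z w : R[i]) :
  (forall c, Re (c * z) = Re (c * w)) -> z = w.
Proof.
move=> h; have := h 1; have := h (- 'i).
by rewrite -!Re_eqM1 -!Im_eqMNi; case: z w {h} => [a b] [c d] /= -> ->.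
Qed.

Lemma norm_Re_le (R : realType) (w : R[i]) : `|Re w| <= Re `|w|.
Proof.
by rewrite normc_def /= -sqrtr_sqr ler_wsqrtr // lerDl sqr_ge0.
Qed.

Lemma norm_Im_le (R : realType) (w : R[i]) : `|Im w| <= Re `|w|.
Proof.
by rewrite normc_def /= -sqrtr_sqr ler_wsqrtr // lerDr sqr_ge0.
Qed.

Lemma norm_Re_mul_le (R : realType) (c w : R[i]) :
  `|Re (c * w)| <= (`|Re c| + `|Im c|) * Re `|w|.
Proof.
rewrite Re_mul (le_trans (ler_normB _ _)) // mulrDl !normrM.
by rewrite lerD // ler_wpM2l // ?norm_Re_le ?norm_Im_le.
Qed.

Lemma norm_le_ReIm (R : realType) (w : R[i]) : `|w| <= (`|Re w| + `|Im w|)%:C.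
Proof.
rewrite normc_def lecR -[leRHS]ger0_norm ?addr_ge0 // -sqrtr_sqr ler_wsqrtr //.
rewrite sqrrD !real_normK ?num_real // lerD2r lerDl.
by rewrite mulrn_wge0 // mulr_ge0.
Qed.

(** Complex convergence phrased through real sequences, so that real limit theorems apply
    directly. *)
Definition cvgC (R : realType) (u : nat -> R[i]) (l : R[i]) : Prop :=
  forall c, Re (c * u n) @[n --> \oo] --> Re (c * l).

Lemma cvgC_of_cvg (R : realType) (u : nat -> R[i]) (l : R[i]) :
  u @ \oo --> (l : R[i]^o) -> cvgC u l.
Proof.
move=> ul c; apply/cvgrPdist_lt => e e0.
pose B := `|Re c| + `|Im c| + 1.
have B0 : 0 < B by rewrite ltr_wpDl ?addr_ge0.
have eB : 0 < (e / B)%:C by rewrite ltcR divr_gt0.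
have {}ul : \forall n \near \oo, `|(l : R[i]^o) - u n| < (e / B)%:C.
  exact: ((@cvgrPdist_lt _ R[i]^o _ _ _ u l).1 ul _ eB).
near=> n; rewrite -raddfB /= -mulrBr.
apply: le_lt_trans (norm_Re_mul_le _ _) _.
have : `|l - u n| < (e / B)%:C by near: n.
rewrite ltcE => /andP[_ /= h].
apply: (@le_lt_trans _ _ (B * Re `|l - u n|)).
  by rewrite ler_wpM2r ?(le_trans _ (norm_Re_le _)) // /B lerDl.
by rewrite mulrC -ltr_pdivlMr.
Unshelve. all: by end_near. Qed.

Lemma cvgC_cst (R : realType) (l : R[i]) : cvgC (fun=> l) l.
Proof. by move=> c; exact: cvg_cst. Qed.

Lemma cvgCB (R : realType) (u v : nat -> R[i]) (l m : R[i]) :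
  cvgC u l -> cvgC v m -> cvgC (fun n => u n - v n) (l - m).
Proof.
move=> ul vm c; rewrite mulrBr raddfB /=.
under eq_fun do rewrite mulrBr raddfB /=.
by apply: cvgB; [exact: ul | exact: vm].
Qed.

Lemma cvgCM (R : realType) (u v : nat -> R[i]) (l m : R[i]) :
  cvgC u l -> cvgC v m -> cvgC (fun n => u n * v n) (l * m).
Proof.
move=> ul vm c; rewrite Re_mulM; under eq_fun do rewrite Re_mulM.
by apply: cvgB; apply: cvgM; [exact: ul | exact: vm | exact: ul | exact: vm].
Qed.

Lemma cvgC_unique (R : realType) (u : nat -> R[i]) (l m : R[i]) :
  cvgC u l -> cvgC u m -> l = m.
Proof.
move=> ul um; apply: complex_eq_Re => c; exact: cvgn_unique (ul c) (um c).
Qed.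

Lemma eq_cvgC (R : realType) (u v : nat -> R[i]) (l : R[i]) :
  u =1 v -> cvgC u l -> cvgC v l.
Proof. by move=> /funext ->. Qed.

Lemma cvgC_Re (R : realType) (u : nat -> R[i]) (l : R[i]) :
  cvgC u l -> Re (u n) @[n --> \oo] --> Re l.
Proof. by move=> /(_ 1); rewrite -Re_eqM1; apply: eq_cvgn => n; rewrite -Re_eqM1. Qed.

Lemma cvgC_Im (R : realType) (u : nat -> R[i]) (l : R[i]) :
  cvgC u l -> Im (u n) @[n --> \oo] --> Im l.
Proof. by move=> /(_ (- 'i)); rewrite -Im_eqMNi; apply: eq_cvgn => n; rewrite -Im_eqMNi. Qed.

Lemma cvgC_cpow (R : realType) (x : R) (u : nat -> R[i]) (l : R[i]) :
  cvgC u l -> cvgC (fun n => cpow x (u n)) (cpow x l).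
Proof.
move=> ul c; rewrite Re_cpow; under eq_fun do rewrite Re_cpow.
have ur : Re (u n) * ln x @[n --> \oo] --> Re l * ln x.
  by apply: cvgM; [exact: cvgC_Re | exact: cvg_cst].
have ui : Im (u n) * ln x @[n --> \oo] --> Im l * ln x.
  by apply: cvgM; [exact: cvgC_Im | exact: cvg_cst].
apply: cvgM; first exact: (continuous_cvg _ (@continuous_expR R _) ur).
apply: cvgB; apply: cvgM; try exact: cvg_cst.
  exact: (continuous_cvg _ (@continuous_cos R _) ui).
exact: (continuous_cvg _ (@continuous_sin R _) ui).
Qed.

(** Dominated convergence: the uniform bound [d <= Re (u n)] provides the common majorant, a
    multiple of [x^(-1-d)]. *)
Lemma cvgC_odd_floor_mellin (R : realType) (u : nat -> R[i]) (l : R[i]) (d : R) :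
  0 < d -> (forall n, d <= Re (u n)) -> cvgC u l -> 0 < Re l ->
  cvgC (fun n => odd_floor_mellin (u n)) (odd_floor_mellin l).
Proof.
move=> d0 ud ul l0 c.
have E s : 0 < Re s -> Re (c * odd_floor_mellin s) =
    \int[mu]_(x in `[1, +oo[) (\1_(odd_floor R) x * Re (c * cpow x (- s - 1))).
  move=> s0; rewrite -Re_cintegral //; last exact: cintegrable_odd_floor.
  apply: eq_Rintegral => x _.
  by move: c (cpow x _) => [a b] [a' b'] /=; ring.
have u0 n : 0 < Re (u n) by exact: lt_le_trans (ud n).
rewrite E //; under eq_fun do rewrite E //.
have [] := @Rintegral_dominated R `[1, +oo[
  (fun n x => \1_(odd_floor R) x * Re (c * cpow x (- u n - 1)))
  (fun x => \1_(odd_floor R) x * Re (c * cpow x (- l - 1)))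
  (fun x => (`|Re c| + `|Im c|) * expR ((- 1 - d) * ln x)) => //.
- move=> n; apply: measurable_funTS; apply: measurable_funM.
    by apply: measurable_indic; exact: measurable_odd_floor.
  exact: measurable_Re_cpow.
- move=> x _; apply: cvgM; first exact: cvg_cst.
  have := @cvgC_cpow _ x _ _ (cvgCB (cvgCB (@cvgC_cst R 0) ul) (@cvgC_cst R 1)) c.
  by rewrite sub0r; apply: eq_cvgn => n; rewrite sub0r.
- exact: (@integrableZl _ _ _ mu _ (measurable_itv `[1, +oo[) (`|Re c| + `|Im c|) _ (integrable_expR_ln d0)).
- move=> n x /=; rewrite in_itv /= andbT => x1; rewrite normrM.
  apply: le_trans (ler_piMl _ (norm_indic_le1 _ _)) _ => //.
  apply: le_trans (norm_Re_cpow_le _ _ _) _.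
  rewrite ler_wpM2l ?addr_ge0 // ler_expR ler_wpM2r ?ln_ge0 //.
  by have := ud n; case: (u n) => a b /=; lra.
Qed.

Lemma eta_zeta_gt1 (R : realType) (zeta : R[i] -> R[i]) (s : R[i]) :
  series (fun n => cpow (n.+1%:R : R) (- s)) @ \oo --> (zeta s : R[i]^o) ->
  0 < Re s ->
  s * odd_floor_mellin s = (1 - cpow (2 : R) (1 - s)) * zeta s.
Proof.
move=> /cvgC_of_cvg zs s0.
pose D n := series (fun m => cpow (2 * m.+1%:R - 1 : R) (- s) -
                             cpow (2 * m.+1%:R : R) (- s)) n.
pose Z n := series (fun n => cpow (n.+1%:R : R) (- s)) n.
(* The even terms of [Z] enter [D] with a minus sign, so they are subtracted twice from the full
   sum: [2 * (2 * k)^(-s) = 2^(1-s) * k^(-s)]. *)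
have DZ n : D n = Z (n.*2)%N - cpow (2 : R) (1 - s) * Z n.
  rewrite /D /Z /series /=; elim: n => [|n IH].
    by rewrite !big_geq // mulr0 subr0.
  rewrite doubleS !big_nat_recr //= IH.
  have -> : 2 * n.+1%:R - 1 = (n.*2).+1%:R :> R.
    by rewrite -!natr1 -mul2n natrM; ring.
  have -> : (n.*2).+2%:R = 2 * n.+1%:R :> R by rewrite -doubleS -mul2n natrM.
  rewrite (@cpowM _ 2 n.+1%:R) ?ltr0n // cpowD.
  have -> : cpow (2 : R) 1 = 2.
    rewrite cpowE /= mul1r mul0r cos0 sin0 mulr1 mulr0 lnK ?posrE //.
    exact: (rmorph_nat (real_complex R) 2).
  by ring.
apply: (@cvgC_unique _ D).
  move=> c; apply: eq_cvgn (@cvg_eta_odd_floor_mellin R c s s0) => n.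
  by rewrite /D /series /= mulr_sumr raddf_sum.
apply: (@eq_cvgC _ (fun n => Z (n.*2)%N - cpow (2 : R) (1 - s) * Z n)).
  by move=> n; rewrite DZ.
rewrite mulrBl mul1r; apply: cvgCB; last exact: cvgCM (@cvgC_cst R _) zs.
move=> c; apply: (cvg_comp _ _ _ (zs c)).
move=> A [N _ NA]; exists N => // n /= Nn; apply: NA => /=.
by rewrite -addnn; exact: leq_trans (leq_addr _ _).
Qed.

(** * Analyticity on horizontal lines *)

Definition line_analytic_at (R : realType) (f : R -> R[i]) (t : R) : Prop :=
  forall c, real_analytic_at (fun u => Re (c * f u)) t.

Lemma line_analyticM (R : realType) (f g : R -> R[i]) (t : R) :
  line_analytic_at f t -> line_analytic_at g t ->
  line_analytic_at (fun u => f u * g u) t.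
Proof.
move=> fa ga c.
rewrite (_ : (fun _ => _) = fun u => Re (c * f u) * Re (1 * g u) +
    -1 * (Re (- 'i * c * f u) * Re (- 'i * g u))); last first.
  by apply/funext => u; rewrite Re_mulM mulN1r.
apply: real_analyticD; first by apply: real_analyticM; [exact: fa | exact: ga].
apply: real_analyticM; first exact: real_analytic_cst.
by apply: real_analyticM; [exact: fa | exact: ga].
Qed.

Lemma line_analytic_horizontal (R : realType) (y t : R) :
  line_analytic_at (fun u => u +i* y) t.
Proof.
move=> c; rewrite (_ : (fun _ => _) = fun u => Re c * u + - (Im c * y)); last first.
  by apply/funext => u; rewrite Re_mul.
apply: real_analyticD; last exact: real_analytic_cst.
by apply: real_analyticM; [exact: real_analytic_cst | exact: real_analytic_id].
Qed.

Lemma line_analytic_1cpow (R : realType) (y t : R) :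
  line_analytic_at (fun u => 1 - cpow (2 : R) (1 - (u +i* y))) t.
Proof.
move=> c.
pose k := expR (ln 2) * (Re c * cos (- y * ln 2) - Im c * sin (- y * ln 2)).
rewrite (_ : (fun _ => _) = fun u => Re c + - k * expR (- ln 2 * u)); last first.
  apply/funext => u; rewrite mulrBr mulr1 raddfB /= Re_cpow /= add0r /k.
  by rewrite (_ : (1 - u) * ln 2 = ln 2 + - ln 2 * u) ?expRD; ring.
apply: real_analyticD; first exact: real_analytic_cst.
by apply: real_analyticM; [exact: real_analytic_cst | exact: real_analytic_expR].
Qed.

(** On the line through [z] in direction [d] the expansion has coefficients [a k * d^k]. The
    direction [1] serves for horizontal lines, ['i] for the vertical approach to a real point. *)
Lemma line_analytic_of_analytic (R : realType) (f : R[i] -> R[i]) (z d : R[i]) (t : R) :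
  analytic_at f z -> `|d| = 1 ->
  line_analytic_at (fun u => f (z + (u - t)%:C * d)) t.
Proof.
move=> [a [r [r0 fa]]] d1 c.
have r0' : 0 < Re r by move: r0; rewrite ltcE => /andP[].
have rE : r = (Re r)%:C.
  by move: r0; rewrite ltcE => /andP[/eqP]; case: (r) => x y /= ->.
exists (fun k => Re (c * (a k * d ^+ k))), (Re r); split => // u ur.
have := fa (z + (u - t)%:C * d); rewrite addrAC subrr add0r normrM d1 mulr1.
rewrite {1}rE normc_def /= expr0n /= addr0 sqrtr_sqr ltcR => /(_ ur).
move=> /cvgC_of_cvg /(_ c); apply: eq_cvgn => n.
rewrite /series /= mulr_sumr raddf_sum; apply: eq_bigr => k _.
rewrite -Re_mulr_real rmorphXn; congr Re.
by rewrite exprMn /=; ring.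
Qed.

Lemma series_exp_coeff_le (R : realType) (x : R) (n : nat) :
  `|series (exp_coeff x) n| <= expR `|x|.
Proof.
have h : series (exp_coeff `|x|) n <= expR `|x|.
  apply: nondecreasing_cvgn_le; last exact: is_cvg_series_exp_coeff.
  by apply: nondecreasing_series => *; exact: exp_coeff_ge0.
apply: le_trans h; apply: le_trans (ler_norm_sum _ _ _) _.
by apply: ler_sum => k _; rewrite /exp_coeff /= normrM normrX normfV normr_nat.
Qed.

Lemma norm_exp_coeff_le (R : realType) (x : R) (n : nat) :
  `|exp_coeff x n| <= expR `|x|.
Proof.
have -> : `|exp_coeff x n| = exp_coeff `|x| n.
  by rewrite /exp_coeff /= normrM normrX normfV normr_nat.
apply: le_trans (_ : series (exp_coeff `|x|) n.+1 <= _).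
  rewrite seriesSr lerDr; apply: sumr_ge0 => k _; exact: exp_coeff_ge0.
have := series_exp_coeff_le `|x| n.+1; rewrite normr_id; apply: le_trans.
exact: ler_norm.
Qed.

(** Expand [expR (- (v - t) * ln u)] in powers of [v - t] and integrate term by term. For
    [|v - t| <= t / 2] the partial sums of the integrand are dominated by [B * u^(-1 - t/2)]. *)
Lemma real_analytic_mellin (R : realType) (w : R -> R) (B t : R) :
  measurable_fun setT w -> (forall u, `|w u| <= B) -> 0 < t ->
  real_analytic_at
    (fun v => \int[mu]_(u in `[1, +oo[) (expR ((- 1 - v) * ln u) * w u)) t.
Proof.
move=> mw wB t0.
have t2 : 0 < t / 2 by rewrite divr_gt0.
pose F (x : R) k u := expR ((- 1 - t) * ln u) * w u * exp_coeff (- x * ln u) k.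
have mE (k : R) : measurable_fun [set: R] (fun u : R => expR (k * ln u)).
  apply: (measurableT_comp (@measurable_expR R)).
  exact: measurable_funM.
have mF x k : measurable_fun setT (F x k).
  apply: measurable_funM; first exact: measurable_funM.
  apply: measurable_funM => //; apply: measurable_funX; exact: measurable_funM.
have ig := @integrableZl _ _ _ mu _ (measurable_itv `[1, +oo[) B _ (integrable_expR_ln t2).
have bd (e x u : R) : 1 <= u -> `|x| <= t / 2 -> `|e| <= expR `|- x * ln u| ->
    `|expR ((- 1 - t) * ln u) * w u * e| <= B * expR ((- 1 - t / 2) * ln u).
  move=> u1 xt he; have l0 : 0 <= ln u by exact: ln_ge0.
  rewrite !normrM (ger0_norm (expR_ge0 _)) mulrAC [leRHS]mulrC ler_pM //.
  apply: le_trans (_ : expR ((- 1 - t) * ln u) * expR `|- x * ln u| <= _).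
    by rewrite ler_wpM2l ?expR_ge0.
  rewrite -expRD ler_expR normrM normrN (ger0_norm l0) -mulrDl ler_wpM2r //; lra.
have iF x k : `|x| <= t / 2 -> mu.-integrable `[1, +oo[ (EFin \o F x k).
  move=> xt; apply: le_integrable ig => //.
    by apply/measurable_EFinP; apply: measurable_funTS; exact: mF.
  move=> u /=; rewrite in_itv /= andbT => u1; rewrite lee_fin.
  apply: le_trans (bd _ x u u1 xt (norm_exp_coeff_le _ _)) _.
  exact: ler_norm.
(* The coefficient is read off from the term at [x = t / 2], whose integrability [iF] provides. *)
exists (fun k => (\int[mu]_(u in `[1, +oo[) F (t / 2) k u) / (t / 2) ^+ k), (t / 2).
split => // v; set x := v - t => /ltW xt.
have [] := @Rintegral_dominated R `[1, +oo[
  (fun n u => series (fun k => F x k u) n)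
  (fun u => expR ((- 1 - v) * ln u) * w u)
  (fun u => B * expR ((- 1 - t / 2) * ln u)) => //.
- move=> n; apply/measurable_EFinP; apply: (measurable_int mu).
  by have [] := @Rintegral_series R _ (F x) n (measurable_itv `[1, +oo[)
    (fun k => iF x k xt).
- move=> u _.
  have -> : expR ((- 1 - v) * ln u) * w u =
      expR ((- 1 - t) * ln u) * w u * expR (- x * ln u).
    by rewrite mulrAC -expRD /x; congr (expR _ * _); ring.
  have : expR ((- 1 - t) * ln u) * w u * series (exp_coeff (- x * ln u)) n
      @[n --> \oo] --> expR ((- 1 - t) * ln u) * w u * expR (- x * ln u).
    by apply: cvgM; [exact: cvg_cst | exact: is_cvg_series_exp_coeff].
  by apply: eq_cvgn => n; rewrite /series /= mulr_sumr.
- move=> n u /=; rewrite in_itv /= andbT => u1.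
  rewrite (_ : series _ n = expR ((- 1 - t) * ln u) * w u *
    series (exp_coeff (- x * ln u)) n); last by rewrite /series /= mulr_sumr.
  by apply: bd u1 xt _; exact: series_exp_coeff_le.
move=> _; apply: eq_cvgn => n.
have [_ ->] := @Rintegral_series R _ (F x) n (measurable_itv `[1, +oo[)
  (fun k => iF x k xt).
apply: eq_bigr => k _.
rewrite -mulrA [_^-1 * _]mulrC -RintegralZr //; last first.
  by apply: iF; rewrite ger0_norm // ltW.
apply: eq_Rintegral => u _; rewrite /F -[RHS]mulrA; congr (_ * _).
rewrite /exp_coeff /= mulrAC; congr (_ / _).
rewrite -expr_div_n -exprMn; congr (_ ^+ _); field; lra.
Qed.

Lemma line_analytic_odd_floor_mellin (R : realType) (y t : R) : 0 < t ->
  line_analytic_at (fun u => odd_floor_mellin (u +i* y)) t.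
Proof.
move=> t0 c.
pose w u := \1_(odd_floor R) u * (Re c * cos (- y * ln u) - Im c * sin (- y * ln u)).
have mln : measurable_fun [set: R] (fun u : R => - y * ln u).
  exact: measurable_funM.
have mw : measurable_fun setT w.
  apply: measurable_funM; first by apply: measurable_indic; exact: measurable_odd_floor.
  apply: measurable_funB; apply: measurable_funM => //.
  - apply: measurableT_comp mln.
    by apply: continuous_measurable_fun; exact: continuous_cos.
  - apply: measurableT_comp mln.
    by apply: continuous_measurable_fun; exact: continuous_sin.
have wB u : `|w u| <= `|Re c| + `|Im c|.
  rewrite /w normrM (le_trans (ler_piMl _ (norm_indic_le1 _ _))) //.
  apply: le_trans (ler_normB _ _) _; rewrite !normrM lerD // ler_piMr //.
    by rewrite ler_norml cos_geN1 cos_le1.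
  by rewrite ler_norml sin_geN1 sin_le1.
have [a [r [r0 ha]]] := real_analytic_mellin mw wB t0.
(* The cap by [t] keeps [v > 0], where the integral defining [K] converges. *)
exists a, (Num.min r t); split; first by rewrite lt_min r0.
move=> v; rewrite lt_min => /andP[vr vt].
have v0 : 0 < v by move: vt; rewrite ltr_norml => /andP[]; lra.
have := ha v vr; congr (_ --> _).
rewrite -Re_cintegral //; last exact: cintegrable_odd_floor.
apply: eq_Rintegral => u _; rewrite [c * (_ * _)]mulrCA.
have -> : Re ((\1_(odd_floor R) u)%:C * (c * cpow u (- (v +i* y) - 1))) =
    \1_(odd_floor R) u * Re (c * cpow u (- (v +i* y) - 1)).
  by move: (c * _) => [p q] /=; ring.
rewrite Re_cpow /= subr0 /w.
by rewrite (_ : - v - 1 = - 1 - v); ring.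
Qed.

(** * Analytic continuation *)

Lemma real_analytic_continuous (R : realType) (f : R -> R) (t : R) :
  real_analytic_at f t -> {for t, continuous f}.
Proof.
move=> /real_analytic_lipschitz[d [K [d0 fK]]].
apply/cvgrPdist_lt => e e0.
have K0 : 0 < `|K| + 1 by rewrite ltr_wpDl.
have m0 : 0 < Num.min d (e / (`|K| + 1)) by rewrite lt_min d0 divr_gt0.
near=> u.
have : `|t - u| < Num.min d (e / (`|K| + 1)).
  by near: u; apply: (@cvgr_dist_lt _ _ _ _ _ id).
rewrite lt_min distrC => /andP[ud]; rewrite ltr_pdivlMr // => ue.
rewrite distrC; apply: le_lt_trans (fK u (ltW ud)) _; apply: le_lt_trans ue.
rewrite mulrC ler_wpM2l // (le_trans (ler_norm K)) // lerDl.
Unshelve. all: by end_near. Qed.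

Lemma cvgC_harmonic (R : realType) (z : nat -> R[i]) (a : R[i]) :
  (forall n, `|a - z n| < (n.+1%:R^-1)%:C) -> cvgC z a.
Proof.
move=> za c; apply/cvgrPdist_lt => e e0.
have B0 : 0 < `|Re c| + `|Im c| + 1 by rewrite ltr_wpDl ?addr_ge0.
near=> n; rewrite -raddfB /= -mulrBr.
apply: le_lt_trans (norm_Re_mul_le _ _) _.
have : n.+1%:R^-1 < e / (`|Re c| + `|Im c| + 1).
  near: n; exact: (near_infty_natSinv_lt (PosNum (divr_gt0 e0 B0))).
rewrite ltr_pdivlMr // => h; apply: le_lt_trans h.
have := za n; rewrite ltcE => /andP[_ /= /ltW h].
by rewrite mulrC ler_pM ?addr_ge0 ?lerDl // (le_trans _ (norm_Re_le _)).
Unshelve. all: by end_near. Qed.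

(** Sequential criterion for a punctured limit, by choosing counterexamples ever closer to [a]. The
    radii start at [1/2], so for [a = 1] all the points have real part at least [1/2]. *)
Lemma cvg_dnbhs_seq (R : realType) (f : R[i] -> R[i]) (a l : R[i]) :
  (forall z : nat -> R[i],
    (forall n, z n != a /\ `|a - z n| < (n.+2%:R^-1)%:C) ->
    cvgC (fun n => f (z n)) l) ->
  f z @[z --> (a : R[i]^o)^'] --> (l : R[i]^o).
Proof.
move=> fz; apply/(@cvgrPdist_lt _ R[i]^o) => e e0; apply: contrapT => nfe.
have [z hz] : exists z : nat -> R[i], forall n,
    (z n != a /\ `|a - z n| < (n.+2%:R^-1)%:C) /\ ~ (`|l - f (z n)| < e).
  suff h n : exists z : R[i],
      (z != a /\ `|a - z| < (n.+2%:R^-1)%:C) /\ ~ (`|l - f z| < e).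
    by have [z hz] := choice h; exists z.
  apply: contrapT => nz; apply: nfe.
  apply/nbhs_ballP; exists (n.+2%:R^-1)%:C; first by rewrite /= ltcR invr_gt0.
  move=> w /= aw wa; apply: contrapT => lw; apply: nz; exists w; split => //.
have zl := fz z (fun n => (hz n).1).
have e0' : 0 < Re e / 2 by move: e0; rewrite ltcE => /andP[_ /= h]; rewrite divr_gt0.
have [n [nr ni]] : exists n, `|Re l - Re (f (z n))| < Re e / 2 /\
    `|Im l - Im (f (z n))| < Re e / 2.
  near \oo => n; exists n; split; near: n.
    by move/cvgrPdist_lt : (cvgC_Re zl); apply.
  by move/cvgrPdist_lt : (cvgC_Im zl); apply.
apply: (hz n).2; apply: le_lt_trans (norm_le_ReIm _) _.
move: e0; rewrite !ltcE => /andP[/eqP -> _] /=; rewrite eqxx /= !raddfB /=.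
by rewrite [ltRHS]splitr ltrD.
Unshelve. all: by end_near. Qed.

Lemma odd_floor_mellin_zeta (R : realType) (zeta : R[i] -> R[i]) (s : R[i]) :
  is_riemann_zeta zeta -> 0 < Re s -> s != 1 ->
  s * odd_floor_mellin s = (1 - cpow (2 : R) (1 - s)) * zeta s.
Proof.
move=> [zan zser] s0 s1.
have offline (t y : R) : 0 < t -> y != 0 ->
    (t +i* y) * odd_floor_mellin (t +i* y) =
    (1 - cpow (2 : R) (1 - (t +i* y))) * zeta (t +i* y).
  move=> t0 y0; apply: complex_eq_Re => c.
  apply: (@real_analytic_identity _
    (fun t => Re (c * ((t +i* y) * odd_floor_mellin (t +i* y))))
    (fun t => Re (c * ((1 - cpow (2 : R) (1 - (t +i* y))) * zeta (t +i* y))))) t0.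
  - move=> u u0; move: c; apply: line_analyticM.
      exact: line_analytic_horizontal.
    exact: line_analytic_odd_floor_mellin.
  - move=> u u0; move: c; apply: line_analyticM; first exact: line_analytic_1cpow.
    rewrite (_ : (fun _ => _) = fun v => zeta ((u +i* y) + (v - u)%:C * 1)).
      apply: line_analytic_of_analytic; last exact: normr1.
      by apply: zan; rewrite eq_complex /= negb_and y0 orbT.
    by apply/funext => v; rewrite mulr1; congr zeta; apply/eqP;
      rewrite eq_complex /= addr0 addrC subrK !eqxx.
  - move=> u u1; congr (Re (c * _)); apply: eta_zeta_gt1 => /=.
      exact: zser.
    exact: lt_trans u1.
have [si|] := eqVneq (Im s) 0; last by move: s0 {s1}; case: s => t y /=; exact: offline.
(* For real [s] the identity holds at these points above [s], and both sides are continuous along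
   them. *)
pose z n : R[i] := s + (n.+1%:R^-1)%:C * 'i.
have ez n : z n = Re s +i* n.+1%:R^-1.
  rewrite /z; move: si; case: (s) => a b /= ->.
  by apply/eqP; rewrite eq_complex /=; apply/andP; split; apply/eqP; ring.
have hn : (n.+1%:R^-1 : R) @[n --> \oo] --> (0 : R) by exact: cvg_harmonic.
have zs : cvgC z s.
  move=> c.
  have : Re (c * s) + Re (c * 'i) * n.+1%:R^-1 @[n --> \oo] --> Re (c * s) + Re (c * 'i) * 0.
    by apply: cvgD; [exact: cvg_cst | apply: cvgM; [exact: cvg_cst | exact: hn]].
  rewrite mulr0 addr0; apply: eq_cvgn => n.
  by rewrite -Re_mulr_real -raddfD /= -mulrA -mulrDr ['i * _]mulrC.
have zzs : cvgC (fun n => zeta (z n)) (zeta s).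
  move=> c.
  have i1 : `|'i : R[i]| = 1 by rewrite normc_def /= expr0n expr1n add0r sqrtr1.
  have := real_analytic_continuous (line_analytic_of_analytic 0 (zan s s1) i1 c).
  move=> /(continuous_cvg _) /(_ hn).
  rewrite subrr mul0r addr0; apply: eq_cvgn => n.
  by rewrite [LHS]/= subr0.
apply: (@cvgC_unique _ (fun n => z n * odd_floor_mellin (z n))).
  apply: (cvgCM zs); apply: (cvgC_odd_floor_mellin s0) => // n.
  by rewrite ez.
apply: (@eq_cvgC _ (fun n => (1 - cpow (2 : R) (1 - z n)) * zeta (z n))).
  by move=> n; rewrite ez offline // invr_neq0.
apply: cvgCM zzs; apply: (cvgCB (@cvgC_cst R 1)).
by apply: cvgC_cpow; exact: (cvgCB (@cvgC_cst R 1) zs).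
Qed.

(** * The identity for [phi], including the limit at 1 *)

Unset Implicit Arguments.
Set Strict Implicit.

Theorem theorem2 (R : realType) (zeta : R[i] -> R[i])
    (hzeta : is_riemann_zeta zeta) (s : R[i]) (hs : 0 < complex.Re s) :
  cintegrable `[1, +oo[ (fun x : R => (phi x)%:C * cpow x (- s - 1)) /\
  s ^+ 2 * cintegral `[1, +oo[ (fun x : R => (phi x)%:C * cpow x (- s - 1)) =
  fill_at 1 (fun z => (1 - cpow (2 : R) (1 - z)) ^+ 2 * zeta z ^+ 2) s.
Proof.
have E1 (x : R) : Re ((phi x)%:C * cpow x (- s - 1)) =
    phi x * Re (1 * cpow x (- s - 1)).
  by rewrite mulrC Re_mulr_real mul1r mulrC.
have Ei (x : R) : Im ((phi x)%:C * cpow x (- s - 1)) =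
    phi x * Re (- 'i * cpow x (- s - 1)).
  by rewrite [LHS]Im_eqMNi [(phi x)%:C * _]mulrC mulrA Re_mulr_real mulrC.
have [i1 e1] := phi_mellin 1 hs; have [ii ei] := phi_mellin (- 'i) hs.
(* The cases [c = 1] and [c = - 'i] of [phi_mellin] are the real and imaginary parts. *)
have I : cintegral `[1, +oo[ (fun x : R => (phi x)%:C * cpow x (- s - 1)) =
    odd_floor_mellin s ^+ 2.
  rewrite /cintegral; under eq_Rintegral do rewrite E1.
  under [X in _ +i* X]eq_Rintegral do rewrite Ei.
  by rewrite e1 ei -Re_eqM1 -Im_eqMNi; case: (_ ^+ 2).
split.
  split.
    by have := i1; congr (_.-integrable _ _); apply/funext => x; rewrite /comp E1.
  by have := ii; congr (_.-integrable _ _); apply/funext => x; rewrite /comp Ei.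
rewrite I -exprMn /fill_at; case: eqVneq => [s1|s1]; last first.
  by rewrite (odd_floor_mellin_zeta hzeta) // exprMn.
(* At [s = 1] the filled value is a limit. Along any sequence of points different from 1 the
   function equals [(z * K(z))^2], and [K] is continuous at 1. *)
apply/esym; apply: (@cvg_lim R[i]^o); first exact: norm_hausdorff.
apply: cvg_dnbhs_seq => z hz.
have zs : cvgC z 1.
  apply: cvgC_harmonic => n; apply: lt_le_trans (hz n).2 _.
  by rewrite lecR lef_pV2 ?posrE ?ltr0n // ler_nat.
have zd n : 2^-1 <= Re (z n).
  have := (hz n).2; rewrite ltcE => /andP[_ /= h].
  have h2 : (n.+2%:R^-1 : R) <= 2^-1 by rewrite lef_pV2 ?posrE ?ltr0n // ler_nat.
  have := le_trans (norm_Re_le _) (le_trans (ltW h) h2).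
  by case: (z n) => a b /=; rewrite ler_norml => /andP[_]; lra.
apply: (@eq_cvgC _ (fun n => (z n * odd_floor_mellin (z n)) * (z n * odd_floor_mellin (z n)))).
  move=> n; rewrite (odd_floor_mellin_zeta hzeta) ?(hz n).1 //; first by rewrite -expr2 exprMn.
  by rewrite (lt_le_trans _ (zd n)) // invr_gt0.
rewrite expr2.
have zK : cvgC (fun n => z n * odd_floor_mellin (z n)) (s * odd_floor_mellin s).
  rewrite s1; apply: (cvgCM zs).
  by apply: (@cvgC_odd_floor_mellin _ _ _ 2^-1) => //; rewrite ?invr_gt0 // -s1.
exact: cvgCM.
Qed.
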